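(* For each $x\in V$ and each nonnegative multiplicity parameter $k:\Phi\to[0,\infty)$, there is a unique probability measure $\pi_{k,x}$ on $V$ supported on the convex hull of the orbit $W_0\cdot x$ such that $$G_{k,s-\rho}(x)=\int_V e^{\langle s,y\rangle}\,\pi_{k,x}(dy)\qquad\text{for all } s\in V_{\mathbb C}.$$
   Context: $V\cong\mathbb R^n$ is a Euclidean space with inner product $\langle\cdot,\cdot\rangle$, extended complex-bilinearly to the complexification $V_{\mathbb C}$. $\Phi\subset V$ is an irreducible crystallographic root system spanning $V$ (not necessarily reduced), $\Phi^+$ a choice of positive roots, $W_0$ the Weyl group generated by the reflections $s_\alpha x=x-2\frac{\langle\alpha,x\rangle}{\langle\alpha,\alpha\rangle}\alpha$. A multiplicity parameter is a $W_0$-invariant function $k$ on $\Phi$. Set $\rho=\frac12\sum_{\alpha\in\Phi^+}k(\alpha)\alpha$. For $\xi\in V$ and $f\in C^1(V)$ the Dunkl–Cherednik operator is $$D_{k,\xi}f(x)=\partial_\xi f(x)+\sum_{\alpha\in\Phi^+}k(\alpha)\frac{\langle\alpha,\xi\rangle}{1-e^{-\langle\alpha,x\rangle}}\big[f(x)-f(s_\alpha x)\big]-\langle\rho,\xi\rangle f(x).$$ For $s\in V_{\mathbb C}$, the Opdam–Cherednik kernel $G_{k,s}\in C^\infty(V)$ is the unique function with $D_{k,\xi}G_{k,s}=\langle s,\xi\rangle G_{k,s}$ for all $\xi\in V$ and $G_{k,s}(0)=1$. *)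

(* Defs.v *)
From HB Require Import structures.
From mathcomp Require Import all_boot all_order all_algebra finmap.
From mathcomp Require Import all_classical all_reals all_analysis.
From mathcomp Require Export complex.
Import Order.TTheory GRing.Theory Num.Theory.
Import numFieldNormedType.Exports.

Set Implicit Arguments.
Unset Strict Implicit.
Unset Printing Implicit Defensive.

Local Open Scope classical_set_scope.
Local Open Scope complex_scope.
Local Open Scope ring_scope.

(* [K] is [R] for the inner product of R^n, and [R[i]] for its
   complex-bilinear (not sesquilinear) extension to C^n. *)
Definition dot (K : pzRingType) (n : nat) (u v : 'rV[K]_n) : K :=
  \sum_(i < n) u 0 i * v 0 i.

Definition complexify (R : realType) (n : nat) (u : 'rV[R]_n) : 'rV[R[i]]_n :=
  map_mx (fun r : R => r%:C) u.

Definition coroot (R : realType) (n : nat) (a : 'rV[R]_n) : 'rV[R]_n :=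
  (2 / dot a a) *: a.

Definition reflection (R : realType) (n : nat) (a x : 'rV[R]_n) : 'rV[R]_n :=
  x - (2 * (dot a x / dot a a)) *: a.

Record irreducible_root_system (R : realType) (n : nat)
    (Phi : {fset 'rV[R]_n}) : Prop := IrreducibleRootSystem {
  root_neq0 : 0 \notin Phi;
  root_span : (<<Phi>> = fullv)%VS;
  root_reflection : forall a b, a \in Phi -> b \in Phi ->
    reflection a b \in Phi;
  root_crystallographic : forall a b, a \in Phi -> b \in Phi ->
    2 * (dot a b / dot a a) \is a Num.int;
  root_nonempty : Phi != fset0;
  root_irreducible : forall Psi : {fset 'rV[R]_n}, (Psi `<=` Phi)%fset ->
    (forall a b, a \in Psi -> b \in (Phi `\` Psi)%fset -> dot a b = 0) ->
    Psi = fset0 \/ Psi = Phi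
}.

Definition positive_system (R : realType) (n : nat)
    (Phi P : {fset 'rV[R]_n}) : Prop :=
  exists v : 'rV[R]_n, (forall a, a \in Phi -> dot a v != 0) /\
    P = [fset a in Phi | 0 < dot a v]%fset.

(* Reflections are involutions, so the monoid they generate is a group. *)
Inductive weyl_group (R : realType) (n : nat) (Phi : {fset 'rV[R]_n}) :
    ('rV[R]_n -> 'rV[R]_n) -> Prop :=
| weyl_id : weyl_group Phi id
| weyl_comp a w : a \in Phi -> weyl_group Phi w ->
    weyl_group Phi (reflection a \o w).

Definition weyl_orbit (R : realType) (n : nat) (Phi : {fset 'rV[R]_n})
    (x : 'rV[R]_n) : set 'rV[R]_n :=
  [set y | exists2 w, weyl_group Phi w & y = w x].

(* Only the values of [k] on [Phi] matter. *)
Definition multiplicity (R : realType) (n : nat) (Phi : {fset 'rV[R]_n})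
    (k : 'rV[R]_n -> R) : Prop :=
  forall w a, weyl_group Phi w -> a \in Phi -> k (w a) = k a.

Definition rho (R : realType) (n : nat) (P : {fset 'rV[R]_n})
    (k : 'rV[R]_n -> R) : 'rV[R]_n :=
  2^-1 *: \sum_(a <- P) k a *: a.

Fixpoint Ck (R : realType) (n m : nat) (f : 'rV[R]_n -> R) : Prop :=
  if m is m'.+1 then
    (forall x, differentiable f x) /\
    (forall v, Ck m' (fun x => 'D_v f x))
  else continuous f.

Definition csmooth (R : realType) (n : nat) (f : 'rV[R]_n -> R[i]) : Prop :=
  forall m, Ck m (fun x => complex.Re (f x)) /\ Ck m (fun x => complex.Im (f x)).

Definition cderive (R : realType) (n : nat) (v : 'rV[R]_n)
    (f : 'rV[R]_n -> R[i]) (x : 'rV[R]_n) : R[i] :=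
  'D_v (fun y => complex.Re (f y)) x +i* 'D_v (fun y => complex.Im (f y)) x.

(* [f x - f (s_a x)] over [1 - e^(- <a, x>)]. On the hyperplane <a, x> = 0 this
   is 0/0, and stands for its continuous extension: since
   s_a x = x - <a, x> *: coroot a, the limit is the derivative along the
   coroot. *)
Definition divided_difference (R : realType) (n : nat) (a : 'rV[R]_n)
    (f : 'rV[R]_n -> R[i]) (x : 'rV[R]_n) : R[i] :=
  if dot a x == 0 then cderive (coroot a) f x
  else (f x - f (reflection a x)) / (1 - expR (- dot a x))%:C.

Definition dunkl_cherednik (R : realType) (n : nat) (P : {fset 'rV[R]_n})
    (k : 'rV[R]_n -> R) (xi : 'rV[R]_n) (f : 'rV[R]_n -> R[i])
    (x : 'rV[R]_n) : R[i] :=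
  cderive xi f x
  + \sum_(a <- P) (k a * dot a xi)%:C * divided_difference a f x
  - (dot (rho P k) xi)%:C * f x.

Definition opdam_cherednik_kernel (R : realType) (n : nat)
    (P : {fset 'rV[R]_n}) (k : 'rV[R]_n -> R) (s : 'rV[R[i]]_n)
    (g : 'rV[R]_n -> R[i]) : Prop :=
  [/\ csmooth g,
      forall xi x, dunkl_cherednik P k xi g x = dot s (complexify xi) * g x &
      g 0 = 1].

Definition cexp (R : realType) (z : R[i]) : R[i] :=
  (expR (complex.Re z))%:C * (cos (complex.Im z) +i* sin (complex.Im z)).

Definition convex_hull (R : realType) (n : nat) (A : set 'rV[R]_n) :
    set 'rV[R]_n :=
  smallest (@convex_set R _) A.

(* R^n with its Borel sigma-algebra. *)
Definition borel_rV (R : realType) (n : nat) :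
    measurableType (sigma_display (@open 'rV[R]_n)) :=
  g_sigma_algebraType (@open 'rV[R]_n).

Definition cintegral (R : realType) (n : nat)
    (mu : {measure set (borel_rV R n) -> \bar R})
    (f : 'rV[R]_n -> R[i]) : R[i] :=
  Rintegral mu setT (fun y => complex.Re (f y)) +i*
  Rintegral mu setT (fun y => complex.Im (f y)).

(* The convex hull of a finite orbit is closed, so the measure is supported on
   it exactly when the complement is null. *)
Definition represents (R : realType) (n : nat) (Phi P : {fset 'rV[R]_n})
    (k : 'rV[R]_n -> R) (G : 'rV[R[i]]_n -> 'rV[R]_n -> R[i])
    (x : 'rV[R]_n) (mu : probability (borel_rV R n) R) : Prop :=
  mu (~` convex_hull (weyl_orbit Phi x)) = 0%E /\
  forall s : 'rV[R[i]]_n,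
    G (s - complexify (rho P k)) x =
    cintegral mu (fun y => cexp (dot s (complexify y))).

(* Main.v *)
Require Import Defs.
From HB Require Import structures.
From mathcomp Require Import all_boot all_order all_algebra finmap.
From mathcomp Require Import all_classical all_reals all_analysis.
From mathcomp Require Import measurable_realfun complex ring lra.
Import Order.TTheory GRing.Theory Num.Theory.
Import numFieldNormedType.Exports.

(** Put s - rho for the spectral parameter and take xi to be the direction of
    the ray t |-> t o, for o in the orbit of x. The eigenvalue equation becomes
      t h' = t <s, o> h + sum_a k_a c(t <a, o>) (F(t s_a o) - F(t o)),
    h(t) = F(t o), with c(v) = v / (1 - e^-v) > 0: a Feynman-Kac equation for a
    jump process on the orbit. Uniformizing by a rate N dominating all jump
    rates gives F(t o) = E[e^(<s, (t - t r) o>) F(t r o')], where r = u^(1/N),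
    u is uniform on [0, 1], and o' is o or a random s_a o. Iterating,
    F(x) = E[e^<s, Y>] with Y = sum_j (t_j - t_(j+1)) o_j, a convex combination
    of points of the orbit, and the measure is the law of Y. All the randomness
    is read off the binary digits of one uniform variable, via a
    measure-preserving map [0, 1] -> [0, 1]^2.

    For uniqueness, exp(- sum_i e^(m^2 (y_i - a_i) - m)) tends to the indicator
    of the orthant y <= a, and on bounded sets it is a convergent series of
    exponentials, so that the integrals of exponentials determine the measures
    of orthants. *)

Set Implicit Arguments.
Unset Strict Implicit.
Unset Printing Implicit Defensive.

Local Open Scope classical_set_scope.
Local Open Scope ring_scope.

(** * Orthants as a generating pi-system *)

(** Shifting by rho cancels the zero-order term of the operator, so at s = 0 what remains
    annihilates constants, as a Markov generator must. The orbit, the weights and the digits do not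
    involve s, which enters only through the exponential at the end: one law serves all s. The rates
    are of order 1/t, so infinitely many steps lie between t = 1 and t = 0, and Y is a limit of
    walks truncated after m steps. F and the truncated means obey the same one-step equation, and
    near t = 0 they differ by at most eps + C t. Each step multiplies the part in t by the mean of
    r, which is N / (N + 1) < 1; the part eps is not contracted and goes to 0 only after m has gone
    to infinity. Complex values are traded for real ones carrying a phase phi: the phases 0 and - pi
    / 2 recover the real and the imaginary part. *)

Section orthants.
Context d (T : measurableType d) (R : realType) (I : finType) (X : I -> T -> R).

Definition orthant (a : I -> R) : set T := [set t | forall i, X i t <= a i].

Lemma orthantI : setI_closed (range orthant).
Proof.
move=> _ _ [a _ <-] [b _ <-]; exists (fun i => Num.min (a i) (b i)) => //.
apply/seteqP; split => t /=.
  by move=> h; split => i; move: (h i); rewrite le_min => /andP[].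
by move=> [ha hb] i; rewrite le_min ha hb.
Qed.

Hypothesis mX : forall i, measurable_fun setT (X i).

Lemma measurable_orthant a : measurable (orthant a).
Proof.
have -> : orthant a = \bigcap_(i in [set: I]) X i @^-1` `]-oo, a i]%classic.
  apply/seteqP; split => t /= h.
    by move=> i _ /=; rewrite in_itv/=; exact: h.
  by move=> i; have := h i Logic.I; rewrite /= in_itv.
apply: fin_bigcap_measurable => // i _.
by rewrite -[X in measurable X]setTI; apply: mX => //; exact: measurable_itv.
Qed.

End orthants.

Section orthants_unique.
Context d (T : measurableType d) (R : realType) (I : finType) (X : I -> T -> R).
Hypothesis mX : forall i, measurable_fun setT (X i).
Hypothesis genX : d.-measurable `<=`
  <<s [set A | exists i x, A = [set t | X i t <= x]] >>.

(** The ray is exhausted by orthants whose other bounds are an integer m. As [I] is finite, one m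
    exceeds all the other coordinates of a given point. *)
Lemma sigma_orthant i x : <<s range (orthant X) >> [set t | X i t <= x].
Proof.
have -> : [set t | X i t <= x] =
    \bigcup_(m : nat) orthant X (fun j => if j == i then x else m%:R).
  apply/seteqP; split => t /=; last first.
    by move=> [m _ /(_ i)]; rewrite eqxx.
  move=> xt.
  pose M := \sum_j `|X j t|.
  exists (Num.trunc M).+1 => // j; case: eqVneq => [->//|_].
  apply: le_trans (ltW (truncnS_gt M)).
  rewrite /M (bigD1 j)//=; apply: le_trans (ler_norm _) _.
  by rewrite lerDl sumr_ge0.
apply: (@bigcupT_measurable _ (g_sigma_algebraType (range (orthant X)))) => m.
by apply: sub_sigma_algebra; eexists.
Qed.

Lemma probability_eq_orthant (P Q : probability T R) :
  (forall a, P (orthant X a) = Q (orthant X a)) ->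
  forall A, measurable A -> P A = Q A.
Proof.
move=> PQ A mA.
have setTG : [set Z | range (orthant X) Z /\ Z `<=` setT] = range (orthant X).
  by apply/seteqP; split=> Z //= -[].
apply: (g_sigma_algebra_measure_unique_trace (range (orthant X)) setT) => //.
- by move=> _ [[a _ <-] _]; exact: measurable_orthant.
- by rewrite setTG; exact: orthantI.
- by apply: etrans (probability_setT P) _; rewrite -(probability_setT Q).
- by move=> _ [[a _ <-] _]; exact: PQ.
- by apply: (@le_lt_trans _ _ 1%E); [exact: probability_le1|exact: ltry].
rewrite setTG.
apply: (smallest_sub _ _ (genX mA)); first exact: smallest_sigma_algebra.
by move=> _ [i [x ->]]; exact: sigma_orthant.
Qed.

End orthants_unique.

Lemma sigma_rays (R : realType) :
  @measurable _ (measurableTypeR R) `<=`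
  <<s [set A | exists x : R, A = [set t | t <= x]] >>.
Proof.
move=> B mB.
have : (@RGenInftyO.G R).-sigma.-measurable B.
  by rewrite -RGenInftyO.measurableE.
apply: smallest_sub; first exact: smallest_sigma_algebra.
move=> _ [x ->].
have -> : `]-oo, x[%classic =
    \bigcup_(m : nat) [set t : R | t <= x - m.+1%:R^-1].
  apply/seteqP; split => t /=; rewrite in_itv/=.
    move=> tx; have := invr_gt0 (x - t); rewrite subr_gt0 tx => i0.
    exists (Num.trunc (x - t)^-1) => //=.
    rewrite lerBrDr -lerBrDl -[leRHS]invrK lef_pV2 ?posrE ?ltr0n//.
    exact/ltW/truncnS_gt.
  move=> [m _ /=] /le_lt_trans; apply.
  by rewrite ltrBlDr ltrDl invr_gt0 ltr0n.
apply: (@bigcupT_measurable _ (g_sigma_algebraType _)) => m.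
by apply: sub_sigma_algebra; exists (x - m.+1%:R^-1).
Qed.

Lemma probability_eq_ray (R : realType) (P Q : probability (measurableTypeR R) R) :
  (forall x, P [set t | t <= x] = Q [set t | t <= x]) ->
  forall A, measurable A -> P A = Q A.
Proof.
move=> PQ A mA.
pose X (_ : unit) (t : measurableTypeR R) : R := t.
apply: (@probability_eq_orthant _ _ _ _ X _ _ P Q) => //.
- by move=> i; exact: measurable_id.
- move=> B /sigma_rays mB.
  apply: (smallest_sub _ _ mB); first exact: smallest_sigma_algebra.
  by move=> _ [x ->]; apply: sub_sigma_algebra; exists tt, x.
- move=> a; have -> : orthant X a = [set t | t <= a tt].
    by apply/seteqP; split => t /=; [exact|move=> h []].
  exact: PQ.
Qed.

Lemma probability_eq_quadrant (R : realType)
    (P Q : probability (measurableTypeR R * measurableTypeR R)%type R) :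
  (forall x y, P [set t | t.1 <= x /\ t.2 <= y] =
               Q [set t | t.1 <= x /\ t.2 <= y]) ->
  forall A, measurable A -> P A = Q A.
Proof.
move=> PQ A mA.
pose X (b : bool) (t : measurableTypeR R * measurableTypeR R) : R :=
  if b then t.1 else t.2.
apply: (@probability_eq_orthant _ _ _ bool X) => //.
- by case; [exact: measurable_fst|exact: measurable_snd].
- move=> B; rewrite measurable_prod_measurableType.
  set S := (X in _ -> <<s X >> _) => mB.
  have mX b C : measurable C -> <<s S >> (X b @^-1` C).
    move=> /sigma_rays mC.
    (* The sets with a good preimage form a sigma-algebra, so it is enough to check rays. *)
    pose F := [set D | <<s S >> (X b @^-1` D)].
    apply: (smallest_sub (X := F) _ _ mC).
      split => /=.
      + by rewrite /F/= preimage_set0; exact: (@measurable0 _ (g_sigma_algebraType S)).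
      + move=> D FD; rewrite setTD /F /= preimage_setC.
        exact: (@measurableC _ (g_sigma_algebraType S)).
      + move=> D FD; rewrite /F/= preimage_bigcup.
        exact: (@bigcupT_measurable _ (g_sigma_algebraType S)).
    by move=> _ [x ->]; apply: sub_sigma_algebra; exists b, x.
  apply: smallest_sub mB; first exact: smallest_sigma_algebra.
  move=> _ [C mC [D mD] <-].
  have -> : C `*` D = X true @^-1` C `&` X false @^-1` D by [].
  by apply: (@measurableI _ (g_sigma_algebraType S)); exact: mX.
- move=> a; have -> : orthant X a = [set t | t.1 <= a true /\ t.2 <= a false].
    apply/seteqP; split => t /=; first by
      move=> h; split; [exact: (h true)|exact: (h false)].
    by move=> [h1 h2] [].
  exact: PQ.
Qed.

Section borel_rV.
Context (R : realType) (n : nat).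

Definition coord_rays : set (set 'rV[R]_n) :=
  [set A | exists (i : 'I_n) (x : R), A = [set t : 'rV[R]_n | t 0 i <= x]].

Lemma coord_measurable_box (y : 'rV[R]_n) (e : R) :
  <<s coord_rays >> [set t : 'rV_n | forall i, `|t 0 i - y 0 i| < e].
Proof.
pose T := g_sigma_algebraType coord_rays.
have -> : [set t : 'rV_n | forall i, `|t 0 i - y 0 i| < e] =
    \bigcap_(i in [set: 'I_n]) ((fun t : T => t 0 i) @^-1` `]y 0 i - e, y 0 i + e[%classic).
  apply/seteqP; split => t /= h i.
    by move=> _ /=; rewrite in_itv/= -ltr_distl.
  by have := h i Logic.I; rewrite /= in_itv/= -ltr_distl.
apply: (@fin_bigcap_measurable _ T) => // i _.
suff : measurable_fun setT (fun t : T => t 0 i).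
  move=> /(_ measurableT `]y 0 i - e, y 0 i + e[%classic (measurable_itv _)).
  by rewrite setTI.
apply: (measurability (@RGenOInfty.G R)).
  exact: RGenOInfty.measurableE.
move=> _ [_ [x ->] <-]; rewrite setTI -[X in measurable X]setCK.
apply: measurableC; apply: sub_sigma_algebra; exists i, x.
by apply/seteqP; split => t /=; rewrite in_itv/= andbT leNgt => /negP.
Qed.

(** Countably many boxes suffice: those of rational centre and radius 1/(m+1) that lie inside [U].
    [F] enumerates them through [pickle], with the empty set at every number that encodes no such
    box. *)
Lemma open_coord_measurable (U : set 'rV[R]_n) :
  open U -> <<s coord_rays >> U.
Proof.
move=> oU; pose T := g_sigma_algebraType coord_rays.
pose box (p : 'rV[rat]_n * nat) : set 'rV[R]_n :=
  [set t | forall i, `|t 0 i - (map_mx ratr p.1 : 'rV[R]_n) 0 i| < p.2.+1%:R^-1].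
pose F (k : nat) := if choice.unpickle k is Some p then
  (if `[< box p `<=` U >] then box p else set0) else set0.
have -> : U = \bigcup_k F k.
  apply/seteqP; split => y; last first.
    move=> [k _]; rewrite /F; case: (choice.unpickle k) => [p|//].
    by case: asboolP => // pU /pU.
  move=> Uy; have /nbhs_ballP[e /= e0 yeU] : nbhs y U by exact: open_nbhs_nbhs.
  (* Both [y] and a point of the box lie within 1/(m+1) of the rational centre, hence within 2/(m+1)
     < e of each other. *)
  pose m := Num.trunc (2 / e).
  have m2 : m.+1%:R^-1 * 2 < e.
    rewrite mulrC ltr_pdivrMr ?ltr0n// -ltr_pdivrMl// mulrC.
    exact: truncnS_gt.
  have m0 : 0 < (m.+1%:R^-1 : R) by rewrite invr_gt0 ltr0n.
  have /boolp.choice[q yq] : forall i : 'I_n, exists q : rat,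
      `|y 0 i - ratr q| < m.+1%:R^-1.
    move=> i; have lt_ball : y 0 i - m.+1%:R^-1 < y 0 i + m.+1%:R^-1.
      by rewrite ltrD2l; apply: lt_trans m0; rewrite oppr_lt0.
    have [q] := rat_in_itvoo lt_ball.
    by rewrite in_itv/= => hq; exists q; rewrite distrC ltr_distl.
  exists (choice.pickle (\row_i q i, m)) => //; rewrite /F choice.pickleK.
  have yb : box (\row_i q i, m) y by move=> i; rewrite /= !mxE.
  case: asboolP => // -[]; move=> z zb; apply: yeU; split => // i j.
  rewrite ord1 /ball/= /ball_/=; apply: le_lt_trans m2.
  rewrite -(subrK (ratr (q j)) (y 0 j)) -addrA.
  apply: le_trans (ler_normD _ _) _; rewrite mulr_natr mulr2n lerD//.
    exact/ltW/yq.
  by rewrite distrC; have := zb j; rewrite /= !mxE => /ltW.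
apply: (@bigcupT_measurable _ T) => k; rewrite /F.
case: (choice.unpickle k) => [p|]; last exact: measurable0.
by case: asboolP => _; [exact: coord_measurable_box|exact: measurable0].
Qed.

Lemma borel_rV_coord : @measurable _ (borel_rV R n) `<=` <<s coord_rays >>.
Proof.
move=> A mA; apply: (smallest_sub _ _ mA); first exact: smallest_sigma_algebra.
exact: open_coord_measurable.
Qed.

Lemma measurable_coord i :
  measurable_fun setT (fun t : borel_rV R n => t 0 i : measurableTypeR R).
Proof.
apply: (measurability (@RGenOInfty.G R)).
  exact: RGenOInfty.measurableE.
move=> _ [_ [x ->] <-]; rewrite setTI; apply: sub_sigma_algebra.
apply: (@open_comp _ _ (fun t : 'rV[R]_n => t 0 i)) => [t _|].
  exact: coord_continuous.
exact: interval_open.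
Qed.

Lemma measurable_fun_rV d (T : measurableType d) (f : T -> borel_rV R n) :
  (forall i, measurable_fun setT (fun t => f t 0 i : measurableTypeR R)) ->
  measurable_fun setT f.
Proof.
move=> mf _ A mA; rewrite setTI.
pose F := [set A | measurable (f @^-1` A)].
apply: (smallest_sub (X := F) _ _ (borel_rV_coord mA)).
  split => /=.
  - by rewrite /F/= preimage_set0.
  - by move=> D FD; rewrite setTD /F /= preimage_setC; exact: measurableC.
  - by move=> D FD; rewrite /F/= preimage_bigcup; exact: bigcupT_measurable.
move=> _ [i [x ->]].
rewrite /F/=.
have := mf i measurableT `]-oo, x]%classic (measurable_itv _).
rewrite setTI; congr measurable.
Qed.

Lemma probability_eq_rV (P Q : probability (borel_rV R n) R) :
  (forall a : 'I_n -> R, P [set t | forall i, t 0 i <= a i] =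
                         Q [set t | forall i, t 0 i <= a i]) ->
  forall A, measurable A -> P A = Q A.
Proof.
move=> PQ; apply: (@probability_eq_orthant _ _ _ _
  (fun i (t : borel_rV R n) => t 0 i : R)) => //.
  by move=> i; exact: measurable_coord.
exact: borel_rV_coord.
Qed.

End borel_rV.

(** * Interleaving the digits of a uniform variable *)

Section unit_uniform.
Context (R : realType).

Definition unit_uniform : probability (measurableTypeR R) R :=
  uniform_prob (@ltr01 R).

Definition clamp (x : R) : R := Num.max 0 (Num.min x 1).

Lemma unit_uniformE (A : set R) : measurable A ->
  unit_uniform A = lebesgue_measure (A `&` `[0, 1]%classic).
Proof.
move=> mA; rewrite /unit_uniform/= /uniform_prob integral_uniform_pdf.
rewrite (eq_integral (fun=> 1%E)); last first.
  move=> x; rewrite inE/= => -[_]; rewrite in_itv/= /uniform_pdf => ->.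
  by rewrite subr0 invr1.
by rewrite integral_cst ?mul1e//; exact: measurableI.
Qed.

Lemma unit_uniform_ray x : unit_uniform [set t | t <= x] = (clamp x)%:E.
Proof.
have -> : [set t | t <= x] = `]-oo, x]%classic.
  by apply/seteqP; split => t /=; rewrite in_itv.
rewrite unit_uniformE; last exact: measurable_itv.
have -> : `]-oo, x]%classic `&` `[0, 1]%classic = `[0, Num.min x 1]%classic.
  apply/seteqP; split => t /=; rewrite !in_itv/= le_min.
    by move=> [-> /andP[-> ->]].
  by move=> /andP[-> /andP[-> ->]].
rewrite lebesgue_measure_itv/= /clamp lte_fin.
case: ltP => h; first by rewrite oppr0 adde0.
by [].
Qed.

(** On [0, 1) this puts the digit [b] in front of the binary expansion: the inverse branches of the
    doubling map. *)
Definition half_branch (b : bool) (x : measurableTypeR R) : measurableTypeR R :=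
  (b%:R + x : R) / 2.

Lemma measurable_half_branch b : measurable_fun setT (half_branch b).
Proof.
apply: continuous_measurable_fun => x.
by apply: cvgMr_tmp; apply: cvgD; [exact: cvg_cst|exact: cvg_id].
Qed.

HB.instance Definition _ b :=
  isMeasurableFun.Build _ _ _ _ (half_branch b) (measurable_half_branch b).

Definition half_mixture : set (measurableTypeR R) -> \bar R :=
  mscale (2^-1)%:nng
    (measure_add (distribution unit_uniform (half_branch false))
                 (distribution unit_uniform (half_branch true))).

HB.instance Definition _ := Measure.on half_mixture.

Lemma half_mixtureE A : half_mixture A =
  ((2^-1)%:E * (unit_uniform (half_branch false @^-1` A) +
               unit_uniform (half_branch true @^-1` A)))%E.
Proof. by rewrite /half_mixture /mscale; congr (_ * _)%E; exact: measure_addE. Qed.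

Let half_mixture_setT : half_mixture setT = 1%E.
Proof.
rewrite half_mixtureE !preimage_setT !probability_setT.
by rewrite -EFinD -EFinM; congr EFin; field.
Qed.

HB.instance Definition _ :=
  Measure_isProbability.Build _ _ _ half_mixture half_mixture_setT.

Lemma clamp_half x : clamp x = 2^-1 * (clamp (2 * x) + clamp (2 * x - 1)).
Proof.
rewrite /clamp.
case: (leP x 1) => h1; case: (leP (2 * x) 1) => h2; case: (leP (2 * x - 1) 1) => h3;
repeat (match goal with |- context [Num.max ?a ?b] => case: (leP a b) => ? end); lra.
Qed.

(** A uniform number is a fair digit followed by a uniform tail. Both sides are probability
    measures, so comparing distribution functions is enough, and there the identity is
    [clamp_half]. *)
Lemma unit_uniform_half A : measurable A -> unit_uniform A =
  ((2^-1)%:E * (unit_uniform (half_branch false @^-1` A) +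
               unit_uniform (half_branch true @^-1` A)))%E.
Proof.
move=> mA; rewrite -half_mixtureE.
apply: (probability_eq_ray (Q := half_mixture)) => // x.
apply: etrans _ (esym (half_mixtureE _)).
rewrite unit_uniform_ray clamp_half EFinM EFinD.
rewrite -!unit_uniform_ray; congr (_ * (_ + _))%E; congr (unit_uniform _);
  by apply/seteqP; split => t /=; rewrite /half_branch /= => ?; lra.
Qed.

End unit_uniform.

Section interleaving.
Context (R : realType).
Local Notation U := (unit_uniform R).

Definition digit (x : R) : bool := 2^-1 <= x.
Definition doubling (x : R) : R := 2 * x - (digit x)%:R.

(** The digits at places 0, 2, 4, ... of the binary expansion, read as an expansion of their own and
    cut after [m] of them. The digits at odd places are those of [doubling x]. *)
Fixpoint even_approx (m : nat) (x : R) : R :=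
  if m is m'.+1 then ((digit x)%:R + even_approx m' (doubling (doubling x))) / 2 else 0.

Definition even_digits (x : R) : R := limn (even_approx^~ x).

Lemma even_approx_ge0 m x : 0 <= even_approx m x.
Proof.
elim: m x => [|m IH] x //=.
by rewrite mulr_ge0 ?invr_ge0// addr_ge0.
Qed.

Lemma even_approx_le1 m x : even_approx m x <= 1.
Proof.
elim: m x => [|m IH] x //=.
rewrite ler_pdivrMr// mul1r (natrD _ 1 1) lerD//.
by case: digit => //=; rewrite ler01.
Qed.

Lemma even_approx_nd x : nondecreasing_seq (even_approx^~ x).
Proof.
apply/nondecreasing_seqP => m.
elim: m x => [|m IH] x; first exact: even_approx_ge0.
by rewrite /= ler_pM2r ?invr_gt0// lerD2l; exact: IH.
Qed.

Lemma cvg_even_approx x : even_approx m x @[m --> \oo] --> even_digits x.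
Proof.
apply: nondecreasing_is_cvgn; first exact: even_approx_nd.
by exists 1 => _ [m _ <-]; exact: even_approx_le1.
Qed.

Lemma even_digits_ge0 x : 0 <= even_digits x.
Proof.
apply: limr_ge; first by apply/cvg_ex; eexists; exact: cvg_even_approx.
by near=> m; exact: even_approx_ge0.
Unshelve. all: by end_near. Qed.

Lemma even_digits_le1 x : even_digits x <= 1.
Proof.
apply: limr_le; first by apply/cvg_ex; eexists; exact: cvg_even_approx.
by near=> m; exact: even_approx_le1.
Unshelve. all: by end_near. Qed.

Lemma even_digits_doubling x :
  even_digits x = ((digit x)%:R + even_digits (doubling (doubling x))) / 2.
Proof.
have h1 : even_approx m.+1 x @[m --> \oo] --> even_digits x.
  by rewrite (cvg_shiftS (even_approx^~ x)); exact: cvg_even_approx.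
have h2 : even_approx m.+1 x @[m --> \oo] -->
    ((digit x)%:R + even_digits (doubling (doubling x))) / 2.
  by apply: cvgMr_tmp; apply: cvgD; [exact: cvg_cst|exact: cvg_even_approx].
exact: cvg_unique h1 h2.
Qed.

Lemma measurable_digit : measurable_fun setT (fun x : R => (digit x)%:R : R).
Proof.
rewrite (_ : (fun x => _) = fun x => if 2^-1 <= x then 1 else 0); last first.
  by apply/funext => x; rewrite /digit; case: ifP.
by apply: measurable_fun_ifT => //; exact: measurable_fun_ler.
Qed.

Lemma measurable_doubling : measurable_fun setT doubling.
Proof.
apply: measurable_funB; last exact: measurable_digit.
by apply: measurable_funM => //; exact: measurable_cst.
Qed.

Lemma measurable_even_digits : measurable_fun setT even_digits.
Proof.
apply: (@measurable_fun_cvg _ _ _ _ even_approx); last first.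
  by move=> x _; exact: cvg_even_approx.
elim=> [|m IH]; first exact: measurable_cst.
apply: measurable_funM; last exact: measurable_cst.
apply: measurable_funD; first exact: measurable_digit.
exact: (measurableT_comp (measurableT_comp IH measurable_doubling) measurable_doubling).
Qed.

Definition split_digits (x : measurableTypeR R) :
    (measurableTypeR R * measurableTypeR R)%type :=
  (even_digits x, even_digits (doubling x)).

Lemma measurable_split_digits : measurable_fun setT split_digits.
Proof.
apply: measurable_fun_pair; first exact: measurable_even_digits.
by apply: measurableT_comp; [exact: measurable_even_digits|exact: measurable_doubling].
Qed.

HB.instance Definition _ :=
  isMeasurableFun.Build _ _ _ _ split_digits measurable_split_digits.

(** A digit put in front moves every other digit by one place, so the two halves exchange roles and
    the new digit heads the first one. The point x = 1 must be left out: 1/2 is read as 0.1000...,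
    not as 0.0111... *)
Lemma split_digits_half b x : 0 <= x < 1 ->
  split_digits (half_branch b x) =
  ((b%:R + even_digits (doubling x)) / 2, even_digits x).
Proof.
move=> /andP[x0 x1].
have dE : digit (half_branch b x) = b.
  rewrite /digit /half_branch; case: b => /=.
    by apply/idP; rewrite mulrDl mul1r lerDl mulr_ge0// invr_ge0.
  apply/negbTE; rewrite -ltNge add0r.
  by rewrite ltr_pdivrMr// mulVf.
have sE : doubling (half_branch b x) = x.
  by rewrite /doubling dE /half_branch; field.
by rewrite /split_digits even_digits_doubling dE sE.
Qed.

(** The endpoint 1 is a null set, so agreement on [0, 1), where [split_digits_half] applies, is
    enough. *)
Lemma unit_uniform_itv (A B : set (measurableTypeR R)) :
  measurable A -> measurable B ->
  (forall x, 0 <= x < 1 -> A x <-> B x) -> U A = U B.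
Proof.
move=> mA mB AB.
have UA C : measurable C -> U C = U (C `&` `[0, 1[%classic).
  move=> mC; rewrite !unit_uniformE//; last by apply: measurableI => //; exact: measurable_itv.
  have -> : C `&` `[0, 1[%classic `&` `[0, 1]%classic = C `&` `[0, 1[%classic.
    apply/seteqP; split => x /=; rewrite !in_itv/=; first by case.
    by move=> [Cx /andP[-> x1]]; rewrite ltW.
  apply/eqP; rewrite eq_le; apply/andP; split; last first.
    rewrite le_measure ?inE//; [by apply: measurableI|by apply: measurableI|].
    by apply: setIS => x /=; rewrite !in_itv/= => /andP[-> /ltW].
  apply: (@le_trans _ _ (lebesgue_measure ((C `&` `[0, 1[%classic) `|` [set 1]))).
    rewrite le_measure ?inE//;
      [by apply: measurableI|apply: measurableU => //; exact: measurableI|].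
    move=> x /=; rewrite !in_itv/= => -[Cx /andP[-> ]].
    by rewrite le_eqVlt => /predU1P[->|->]; [right|left].
  apply: le_trans (measureU2 _ _ _) _ => //; first exact: measurableI.
  by rewrite [X in (_ + X)%E](lebesgue_measure_set1 1) adde0.
rewrite UA// [RHS]UA//; congr (U _); apply/seteqP; split => x /=; rewrite in_itv/=.
  by move=> [/AB h h']; split => //; exact: h.
by move=> [/AB h h']; split => //; exact: h.
Qed.

Definition digit_cdf (x y : R) : R :=
  fine (U [set t | even_digits t <= x /\ even_digits (doubling t) <= y]).

Lemma measurable_digit_quadrant x y :
  measurable [set t : measurableTypeR R |
    even_digits t <= x /\ even_digits (doubling t) <= y].
Proof.
have -> : [set t : measurableTypeR R |
      even_digits t <= x /\ even_digits (doubling t) <= y] =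
    split_digits @^-1` (`]-oo, x]%classic `*` `]-oo, y]%classic).
  by apply/seteqP; split => t /=; rewrite !in_itv.
rewrite -[X in measurable X]setTI; apply: measurable_split_digits => //.
by apply: measurableX; exact: measurable_itv.
Qed.

Lemma digit_cdfE x y : U [set t | even_digits t <= x /\ even_digits (doubling t) <= y]
  = (digit_cdf x y)%:E.
Proof. by rewrite fineK// fin_num_measure//; exact: measurable_digit_quadrant. Qed.

(** Conditioning on the first digit, which rescales the bound on the first half and exchanges the
    halves: hence the swapped arguments. *)
Lemma digit_cdf_half x y :
  digit_cdf x y = 2^-1 * (digit_cdf y (2 * x) + digit_cdf y (2 * x - 1)).
Proof.
apply: EFin_inj; rewrite EFinM EFinD -!digit_cdfE unit_uniform_half; last first.
  exact: measurable_digit_quadrant.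
congr (_ * (_ + _))%E; apply: unit_uniform_itv;
  try exact: measurable_digit_quadrant;
  try (rewrite -[X in measurable X]setTI; apply: measurable_half_branch => //;
    exact: measurable_digit_quadrant).
- move=> t /(split_digits_half false)[/= -> ->].
  by split=> -[h1 h2]; split; lra.
- move=> t /(split_digits_half true)[/= -> ->].
  by split=> -[h1 h2]; split; lra.
Qed.

Lemma digit_cdf_ge0 x y : 0 <= digit_cdf x y.
Proof. exact: fine_ge0. Qed.

Lemma digit_cdf_le1 x y : digit_cdf x y <= 1.
Proof.
rewrite -lee_fin -digit_cdfE; apply: probability_le1.
exact: measurable_digit_quadrant.
Qed.

Lemma digit_cdf_lt0 x y : x < 0 \/ y < 0 -> digit_cdf x y = 0.
Proof.
move=> xy; apply: EFin_inj; rewrite -digit_cdfE.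
rewrite (_ : [set t | _] = set0) ?measure0//.
apply/seteqP; split => t //= -[h1 h2].
have := even_digits_ge0 t; have := even_digits_ge0 (doubling t); lra.
Qed.

Lemma digit_cdf_ge1r x y : 1 <= y -> digit_cdf x y = digit_cdf x 1.
Proof.
move=> y1; apply: EFin_inj; rewrite -!digit_cdfE; congr (U _).
apply/seteqP; split => t /= -[h1 h2]; split => //; first exact: even_digits_le1.
exact: le_trans h2 y1.
Qed.

Lemma digit_cdf_ge1l x y : 1 <= x -> digit_cdf x y = digit_cdf 1 y.
Proof.
move=> y1; apply: EFin_inj; rewrite -!digit_cdfE; congr (U _).
apply/seteqP; split => t /= -[h1 h2]; split => //; first exact: even_digits_le1.
exact: le_trans h1 y1.
Qed.

Lemma digit_cdf11 : digit_cdf 1 1 = 1.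
Proof.
apply: EFin_inj; rewrite -digit_cdfE -(probability_setT U); congr (U _).
by apply/seteqP; split => t //= _; split; exact: even_digits_le1.
Qed.

Lemma clamp_ge0 (x : R) : 0 <= clamp x. Proof. by rewrite /clamp le_max lexx. Qed.
Lemma clamp_le1 (x : R) : clamp x <= 1.
Proof. by rewrite /clamp ge_max ler01 ge_min lexx orbT. Qed.
Lemma clamp_lt0 (x : R) : x < 0 -> clamp x = 0.
Proof. by move=> x0; apply: max_l; rewrite ge_min (ltW x0). Qed.
Lemma clamp_ge1 (x : R) : 1 <= x -> clamp x = 1.
Proof. by move=> x1; rewrite /clamp (min_r x1) max_r. Qed.

Lemma eq0_half_pow (a : R) : (forall k, `|a| <= 2^-1 ^+ k) -> a = 0.
Proof.
move=> ha; apply/eqP; rewrite -normr_le0.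
have h : (2^-1 : R) ^+ k @[k --> \oo] --> (0 : R).
  by apply: cvg_expr; rewrite ger0_norm ?invr_ge0// invf_lt1 ?ltr1n.
rewrite -(cvg_lim _ h)//; apply: limr_ge; first by apply/cvg_ex; exists 0.
by near=> k; exact: ha.
Unshelve. all: by end_near. Qed.

(** Both sides obey the same halving equation. In the equation for their difference [D] one of the
    two terms always vanishes, because 2x - 1 < 0 or 2x >= 1. So a bound on |D| can be halved again
    and again. *)
Lemma digit_cdf_marginal x : digit_cdf x 1 = clamp x.
Proof.
apply/eqP; rewrite -subr_eq0; apply/eqP.
pose D x := digit_cdf x 1 - clamp x; rewrite -/(D x).
have D0 z : z < 0 -> D z = 0.
  by move=> z0; rewrite /D digit_cdf_lt0 ?clamp_lt0 ?subrr//; left.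
have D1 z : 1 <= z -> D z = 0.
  by move=> z1; rewrite /D digit_cdf_ge1l// digit_cdf11 clamp_ge1// subrr.
(* At first argument 1 the halving equation averages the values at (z, 2) and (z, 1), which are
   equal: the two marginals coincide. *)
have first_half z : digit_cdf 1 z = digit_cdf z 1.
  rewrite digit_cdf_half digit_cdf_ge1r; last by lra.
  by rewrite (_ : 2 * 1 - 1 = 1); [field|ring].
have Dh z : D z = 2^-1 * (D (2 * z) + D (2 * z - 1)).
  by rewrite /D digit_cdf_half !first_half clamp_half; ring.
apply: eq0_half_pow => k; elim: k x => [|k IH] x.
  have := digit_cdf_ge0 x 1; have := digit_cdf_le1 x 1.
  have := clamp_ge0 x; have := clamp_le1 x.
  by rewrite /D expr0 ler_norml => ? ? ? ?; apply/andP; split; lra.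
rewrite Dh normrM ger0_norm ?invr_ge0// exprS ler_pM2l ?invr_gt0//.
have [x2|x2] := ltP (2 * x) 1.
  by rewrite [D (2 * x - 1)]D0 ?addr0; [exact: IH|lra].
by rewrite [D (2 * x)]D1 ?add0r.
Qed.

(** The contraction used for the marginal works again, since the product of the two [clamp]s also
    solves the halving equation with swapped arguments. The marginal is what makes a term vanish
    when its second argument is at least 1. *)
Lemma digit_cdf_clamp x y : digit_cdf x y = clamp x * clamp y.
Proof.
apply/eqP; rewrite -subr_eq0; apply/eqP.
pose D x y := digit_cdf x y - clamp x * clamp y; rewrite -/(D x y).
have D0 x' z : z < 0 -> D x' z = 0.
  by move=> z0; rewrite /D digit_cdf_lt0 ?(clamp_lt0 z0) ?mulr0 ?subrr//; right.
have D1 x' z : 1 <= z -> D x' z = 0.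
  by move=> z1; rewrite /D digit_cdf_ge1r// digit_cdf_marginal (clamp_ge1 z1) mulr1 subrr.
have Dh x' z : D x' z = 2^-1 * (D z (2 * x') + D z (2 * x' - 1)).
  by rewrite /D digit_cdf_half [in LHS](clamp_half x'); ring.
apply: eq0_half_pow => k; elim: k x y => [|k IH] x y.
  have := digit_cdf_ge0 x y; have := digit_cdf_le1 x y.
  have : 0 <= clamp x * clamp y by rewrite mulr_ge0// clamp_ge0.
  have : clamp x * clamp y <= 1.
    by rewrite mulr_ile1 ?clamp_ge0 ?clamp_le1.
  by rewrite /D expr0 ler_norml => ? ? ? ?; apply/andP; split; lra.
rewrite Dh normrM ger0_norm ?invr_ge0// exprS ler_pM2l ?invr_gt0//.
have [x2|x2] := ltP (2 * x) 1.
  by rewrite [D y (2 * x - 1)]D0 ?addr0; [exact: IH|lra].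
by rewrite [D y (2 * x)]D1 ?add0r.
Qed.

(** The two halves are independent and uniform, so one uniform variable can be split as often as the
    walk has steps. *)
Lemma split_digits_law (A : set (measurableTypeR R * measurableTypeR R)) :
  measurable A -> U (split_digits @^-1` A) = (U \x U)%E A.
Proof.
move=> mA; change (distribution U split_digits A = (U \x U)%E A).
apply: probability_eq_quadrant mA => x y.
transitivity ((digit_cdf x y)%:E); first by rewrite -digit_cdfE.
rewrite digit_cdf_clamp EFinM -!unit_uniform_ray.
have -> : [set t : measurableTypeR R * measurableTypeR R | t.1 <= x /\ t.2 <= y] =
  [set t | t <= x] `*` [set t | t <= y] by [].
apply/esym; apply: product_measure1E; rewrite -[X in measurable X]setTI;
  exact: measurable_fun_ler.
Qed.

End interleaving.

(** * Expectations of bounded functions *)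

Section bounded_integral.
Context d (T : measurableType d) (R : realType) (P : probability T R).

Definition bounded_mfun (f : T -> R) :=
  measurable_fun setT f /\ exists M, forall x, `|f x| <= M.

Lemma bounded_mfun_integrable f : bounded_mfun f -> P.-integrable setT (EFin \o f).
Proof.
move=> [mf [M fM]]; apply: measurable_bounded_integrable => //.
  by rewrite [ltLHS]probability_setT ltry.
by exists M; split; [exact: num_real|move=> K MK x _; exact: le_trans (fM x) (ltW MK)].
Qed.

Lemma bounded_mfun_cst c : bounded_mfun (fun=> c).
Proof. by split; [exact: measurable_cst|exists `|c|]. Qed.

Lemma bounded_mfunD f g : bounded_mfun f -> bounded_mfun g ->
  bounded_mfun (fun x => f x + g x).
Proof.
move=> [mf [M fM]] [mg [N gN]]; split; first exact: measurable_funD.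
by exists (M + N) => x; apply: le_trans (ler_normD _ _) _; exact: lerD.
Qed.

Lemma bounded_mfunM f g : bounded_mfun f -> bounded_mfun g ->
  bounded_mfun (fun x => f x * g x).
Proof.
move=> [mf [M fM]] [mg [N gN]]; split; first exact: measurable_funM.
by exists (M * N) => x; rewrite normrM ler_pM.
Qed.

Lemma bounded_mfunB f g : bounded_mfun f -> bounded_mfun g ->
  bounded_mfun (fun x => f x - g x).
Proof.
move=> [mf [M fM]] [mg [N gN]]; split; first exact: measurable_funB.
by exists (M + N) => x; apply: le_trans (ler_normB _ _) _; exact: lerD.
Qed.

Lemma meanD f g : bounded_mfun f -> bounded_mfun g ->
  \int[P]_x (f x + g x) = \int[P]_x f x + \int[P]_x g x.
Proof. by move=> bf bg; apply: RintegralD => //; exact: bounded_mfun_integrable. Qed.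

Lemma meanB f g : bounded_mfun f -> bounded_mfun g ->
  \int[P]_x (f x - g x) = \int[P]_x f x - \int[P]_x g x.
Proof. by move=> bf bg; apply: RintegralB => //; exact: bounded_mfun_integrable. Qed.

Lemma meanZl c f : bounded_mfun f ->
  \int[P]_x (c * f x) = c * \int[P]_x f x.
Proof. by move=> bf; apply: RintegralZl => //; exact: bounded_mfun_integrable. Qed.

Lemma mean_cst c : \int[P]_x c = c.
Proof.
rewrite Rintegral_cst//.
by rewrite (_ : fine (P setT) = 1) ?mulr1// probability_setT.
Qed.

Lemma mean_le f g : bounded_mfun f -> bounded_mfun g ->
  (forall x, f x <= g x) -> \int[P]_x f x <= \int[P]_x g x.
Proof.
by move=> bf bg fg; apply: le_Rintegral => //; exact: bounded_mfun_integrable.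
Qed.

Lemma mean_norm_le f g : bounded_mfun f -> bounded_mfun g ->
  (forall x, `|f x| <= g x) -> `|\int[P]_x f x| <= \int[P]_x g x.
Proof.
move=> bf bg fg; apply: le_trans (le_normr_Rintegral _ _) _ => //.
  exact: bounded_mfun_integrable.
apply: mean_le => //; have [mf [M fM]] := bf; split.
  exact: measurableT_comp.
by exists M => x; rewrite normr_id.
Qed.

Lemma mean_cvg (f_ : nat -> T -> R) (f : T -> R) (M : R) :
  (forall m, measurable_fun setT (f_ m)) ->
  (forall m x, `|f_ m x| <= M) ->
  (forall x, f_ m x @[m --> \oo] --> f x) ->
  \int[P]_x f_ m x @[m --> \oo] --> \int[P]_x f x.
Proof.
move=> mf fM ff.
have mfl : measurable_fun setT f by exact: measurable_fun_cvg mf (fun x _ => ff x).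
have bf : bounded_mfun f.
  split => //; exists M => x.
  rewrite -(cvg_lim _ (cvg_norm (ff x)))//; apply: limr_le.
    by apply/cvg_ex; eexists; exact: (cvg_norm (ff x)).
  by near=> m; exact: fM.
have [] := @dominated_convergence _ T R P setT measurableT
  (fun m => EFin \o f_ m) (EFin \o f) (EFin \o (fun=> M)).
- by move=> m; apply/measurable_EFinP.
- exact/measurable_EFinP.
- by apply: aeW => x _; apply: cvg_EFin; [near=> m|exact: ff].
- exact: (bounded_mfun_integrable (bounded_mfun_cst M)).
- by apply: aeW => x m _; rewrite /= lee_fin.
move=> _ _ h; apply: fine_cvg.
rewrite /Rintegral fineK; last first.
  by apply: integrable_fin_num => //; exact: bounded_mfun_integrable.
exact: h.
Unshelve. all: by end_near. Qed.

Lemma mean_indic (A : set T) : measurable A ->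
  \int[P]_x (\1_A x) = fine (P A).
Proof. by move=> mA; rewrite /Rintegral integral_indic// setIT. Qed.

End bounded_integral.

Section split_expectation.
Context (R : realType).
Local Notation U := (unit_uniform R).
Local Notation M := (measurableTypeR R).

Lemma bounded_mfun_partial d (T : measurableType d) (Q : probability M R)
    (f : T * M -> R) : bounded_mfun f ->
  bounded_mfun (fun x => \int[Q]_y f (x, y)).
Proof.
move=> [mf [B fB]]; split.
  (* Adding the bound [B] makes the integrand nonnegative, as Tonelli's theorem asks. *)
  pose g (p : T * M) := (f p + B)%:E.
  have mg : measurable_fun setT g.
    apply/measurable_EFinP; apply: measurable_funD => //; exact: measurable_cst.
  have g0 p : (0 <= g p)%E.
    by rewrite lee_fin -lerBlDr sub0r; have := fB p; rewrite ler_norml => /andP[].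
  have mG := @measurable_fun_fubini_tonelli_F _ _ T M R Q g mg g0.
  have -> : (fun x => \int[Q]_y f (x, y)) =
      (fun x => fine (fubini_F Q g x) - B).
    apply/funext => x; rewrite /fubini_F /g.
    have bfx : bounded_mfun (fun y => f (x, y)).
      split; last by exists B.
      by apply: measurableT_comp mf _; exact: measurable_pair1.
    have -> : fine (\int[Q]_y (f (x, y) + B)%:E) = \int[Q]_y (f (x, y) + B) by [].
    by rewrite meanD ?mean_cst ?addrK//; exact: bounded_mfun_cst.
  apply: measurable_funB; last exact: measurable_cst.
  by apply: measurableT_comp mG; exact: fine_measurable.
exists B => x.
have mfx : bounded_mfun (fun y => f (x, y)).
  split; last by exists B.
  by apply: measurableT_comp mf _; exact: measurable_pair1.
rewrite -[leRHS](mean_cst Q); apply: mean_norm_le => //.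
exact: bounded_mfun_cst.
Qed.

Lemma mean_split (f : M * M -> R) : bounded_mfun f ->
  \int[U]_w f (split_digits w) = \int[U]_u \int[U]_v f (u, v).
Proof.
move=> bf; have [mf [B fB]] := bf.
have if2 := @bounded_mfun_integrable _ _ R (U \x U)%E f bf.
have -> : \int[U]_w f (split_digits w) = \int[distribution U (@split_digits R)]_p f p.
  rewrite /Rintegral integral_distribution//; first exact/measurable_EFinP.
  apply: (@bounded_mfun_integrable _ _ R U (f \o @split_digits R)).
  split; last by exists B => x; exact: fB.
  by apply: measurableT_comp => //; exact: measurable_split_digits.
rewrite /Rintegral.
rewrite (eq_measure_integral (U \x U)%E); last by move=> A mA _; exact: split_digits_law.
rewrite -(integral12_prod_meas1 if2); congr fine; apply: eq_integral => u _.
rewrite /fubini_F /= fineK//; apply: integrable_fin_num => //.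
apply: (bounded_mfun_integrable U (f := fun y => f (u, y))); split; last by exists B.
by apply: measurableT_comp mf _; exact: measurable_pair1.
Qed.

End split_expectation.

(** * Drawing from a weighted list with one uniform variable *)

Section select.
Context (R : realType) (V : eqType).

Definition weight_sum (q : V -> R) (l : seq V) : R := \sum_(a <- l) q a.

(** For nonnegative weights the intervals (W, W + q a], W being the weight of the rest of the list,
    are disjoint and fill (0, total]; above the total the outcome is [x0]. The type of outcomes is
    left free so that vectors, reals and functions can all be drawn, and [select_map] passes between
    them. *)
Fixpoint select (X : Type) (q : V -> R) (A : V -> X) (x0 : X) (l : seq V) (v : R) : X :=
  if l is a :: l' then
    if (weight_sum q l' < v) && (v <= weight_sum q l' + q a) then A a
    else select q A x0 l' v
  else x0.

Lemma select_map (X Y : Type) (f : X -> Y) q A x0 l v :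
  f (select q A x0 l v) = select q (f \o A) (f x0) l v.
Proof. by elim: l => //= a l <-; case: ifP. Qed.

Lemma select_ind (X : Type) (Q : X -> Prop) q A x0 l v :
  (forall a, a \in l -> Q (A a)) -> Q x0 -> Q (select q A x0 l v).
Proof.
move=> + Q0; elim: l => //= a l IH h; case: ifP => _.
  by apply: h; rewrite mem_head.
by apply: IH => b bl; apply: h; rewrite in_cons bl orbT.
Qed.

Lemma select_ind2 (X Y : Type) (Q : X -> Y -> Prop) q A A' x0 y0 l v :
  (forall a, a \in l -> Q (A a) (A' a)) -> Q x0 y0 ->
  Q (select q A x0 l v) (select q A' y0 l v).
Proof.
move=> + Q0; elim: l => //= a l IH h; case: ifP => _.
  by apply: h; rewrite mem_head.
by apply: IH => b bl; apply: h; rewrite in_cons bl orbT.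
Qed.

Lemma weight_sum_cons q a l : weight_sum q (a :: l) = weight_sum q l + q a.
Proof. by rewrite /weight_sum big_cons addrC. Qed.

Lemma weight_sum_ge0 q l : (forall a, a \in l -> 0 <= q a) -> 0 <= weight_sum q l.
Proof. by move=> q0; rewrite /weight_sum big_seq sumr_ge0. Qed.

Lemma select_large (X : Type) q (A : V -> X) x0 l v :
  (forall a, a \in l -> 0 <= q a) -> weight_sum q l < v -> select q A x0 l v = x0.
Proof.
elim: l => //= a l IH q0; rewrite weight_sum_cons => lv.
rewrite leNgt lv andbF; apply: IH => [b bl|].
  by apply: q0; rewrite in_cons bl orbT.
by apply: le_lt_trans lv; rewrite lerDl q0// mem_head.
Qed.

Lemma measurable_select d (T : measurableType d) (q : T -> V -> R)
    (A : T -> V -> R) x0 l v :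
  (forall a, measurable_fun setT (q^~ a)) ->
  (forall a, measurable_fun setT (A^~ a)) ->
  measurable_fun setT x0 -> measurable_fun setT v ->
  measurable_fun setT (fun t => select (q t) (A t) (x0 t) l (v t)).
Proof.
move=> mq mA mx mv; elim: l => //= a l IH.
have mt : measurable_fun setT (fun t => weight_sum (q t) l).
  by apply: measurable_sum.
apply: measurable_fun_ifT => //.
apply: measurable_and; first exact: measurable_fun_ltr.
by apply: measurable_fun_ler => //; exact: measurable_funD.
Qed.

Lemma clamp_id (x : R) : 0 <= x <= 1 -> clamp x = x.
Proof. by move=> /andP[x0 x1]; rewrite /clamp (min_l x1) max_r. Qed.

Lemma mean_select q (A : V -> R) x0 l :
  (forall a, a \in l -> 0 <= q a) -> weight_sum q l <= 1 ->
  \int[unit_uniform R]_v select q A x0 l v =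
  x0 + \sum_(a <- l) q a * (A a - x0).
Proof.
elim: l => [|a l IH] q0; first by rewrite mean_cst big_nil addr0.
rewrite weight_sum_cons => q1.
have q0' b : b \in l -> 0 <= q b by move=> bl; apply: q0; rewrite in_cons bl orbT.
have qa : 0 <= q a by rewrite q0// mem_head.
have t0 := weight_sum_ge0 q0'.
have bray x : bounded_mfun (\1_[set v : measurableTypeR R | v <= x] : _ -> R).
  split.
    apply: measurable_indic; rewrite -[X in measurable X]setTI.
    exact: measurable_fun_ler.
  by exists 1 => v; rewrite indicE; case: (_ \in _); rewrite ?normr0 ?normr1.
have eray x : 0 <= x <= 1 ->
    \int[unit_uniform R]_v (\1_[set v : measurableTypeR R | v <= x] v) = x.
  move=> x01; rewrite mean_indic.
    by apply: EFin_inj; rewrite unit_uniform_ray/= clamp_id.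
  by rewrite -[X in measurable X]setTI; exact: measurable_fun_ler.
have bl : bounded_mfun (fun v : measurableTypeR R => select q A x0 l v).
  split; first by
    apply: (@measurable_select _ (measurableTypeR R) (fun=> q) (fun=> A) (fun=> x0)).
  exists (`|x0| + \sum_(b <- l) `|A b|) => v.
  apply: (@select_ind R (fun y => `|y| <= `|x0| + \sum_(b <- l) `|A b|)) => [b bl'|];
    last by rewrite lerDl sumr_ge0.
  rewrite (big_rem b)//= addrCA lerDl addr_ge0// sumr_ge0//.
(* A new head changes the outcome only on its own interval, from [x0] to [A a]. The indicator of
   that interval is a difference of indicators of rays. *)
rewrite (_ : (fun v => select _ _ _ _ _) = (fun v => select q A x0 l v +
    (A a - x0) * (\1_[set v : measurableTypeR R | v <= weight_sum q l + q a] v -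
                  \1_[set v : measurableTypeR R | v <= weight_sum q l] v))); last first.
  apply/funext => v /=; rewrite !indicE.
  have -> : (v \in [set v : measurableTypeR R | v <= weight_sum q l + q a]) =
      (v <= weight_sum q l + q a) by apply/idP/idP; rewrite inE.
  have -> : (v \in [set v : measurableTypeR R | v <= weight_sum q l]) =
      (v <= weight_sum q l) by apply/idP/idP; rewrite inE.
  have [lv/=|lv/=] := ltP (weight_sum q l) v.
    rewrite (select_large _ _ q0' lv) subr0.
    by case: leP => _; rewrite ?mulr1 ?mulr0; [rewrite addrC subrK|rewrite addr0].
  by rewrite (le_trans lv) ?subrr ?mulr0 ?addr0// lerDl.
rewrite meanD//; last first.
  by apply: bounded_mfunM; [exact: bounded_mfun_cst|exact: bounded_mfunB].
rewrite meanZl; last exact: bounded_mfunB.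
rewrite meanB// IH//; last by apply: le_trans q1; rewrite lerDl.
have tq0 : 0 <= weight_sum q l <= 1 by rewrite t0 (le_trans _ q1)// lerDl.
have tq1 : 0 <= weight_sum q l + q a <= 1 by rewrite q1 addr_ge0.
by rewrite !eray// big_cons; ring.
Qed.

End select.

(** * Integration along a ray *)

Section radial.
Context (R : realType) (N : R).
Hypothesis N0 : 0 < N.
Local Notation U := (unit_uniform R).

(** The ratio of two successive times. For [u] uniform its - log is exponential of rate [N]: in the
    time - log t, which absorbs the factor 1/t of the rates, the steps follow a Poisson clock.
    [clamp] keeps the value in [0, 1] for every real [u]. *)
Definition shrink (u : R) : R := clamp u `^ N^-1.

Lemma measurable_clamp : measurable_fun setT (@clamp R).
Proof.
by apply: measurable_maxr => //; apply: measurable_minr.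
Qed.

Lemma measurable_shrink : measurable_fun setT shrink.
Proof.
exact: (measurableT_comp (measurable_powR N^-1) measurable_clamp).
Qed.

Lemma shrink_ge0 u : 0 <= shrink u. Proof. exact: powR_ge0. Qed.

Lemma shrink_le1 u : shrink u <= 1.
Proof.
have <- : 1 `^ N^-1 = 1 by rewrite powR1.
rewrite /shrink; apply: ge0_ler_powR; rewrite ?nnegrE ?clamp_ge0//.
  by rewrite invr_ge0 ltW.
exact: clamp_le1.
Qed.

Lemma cvg_shrink0 : u `^ N^-1 @[u --> 0^'+] --> (0 : R).
Proof. by apply: powR_cvg0; rewrite invr_gt0. Qed.

Lemma continuous_root (u : R) : 0 < u -> {for u, continuous (fun u => u `^ N^-1)}.
Proof.
move=> u0; have [/derivable1_diffP/differentiable_continuous] := is_derive1_powR N^-1 u0.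
by [].
Qed.

Section ftc.
Variables h p : R -> R.
Hypothesis ch : continuous h.
Hypothesis cp : continuous p.
Hypothesis dh : forall r : R, 0 < r < 1 -> is_derive r 1 h (N * (p r - h r) / r).

(** The equation for [h] says that r^N h(r) has derivative N r^(N-1) p(r). The substitution r =
    u^(1/N) absorbs the weight and leaves p(u^(1/N)) as the derivative of [G]. *)
Let G u : R := u * h (u `^ N^-1).

Let dG (u : R) : 0 < u < 1 -> is_derive u 1 G (p (u `^ N^-1)).
Proof.
move=> /andP[u0 u1].
have r0 : 0 < u `^ N^-1 by rewrite powR_gt0.
have r1 : u `^ N^-1 < 1.
  have <- : 1 `^ N^-1 = 1 by rewrite powR1.
  by apply: gt0_ltr_powR; rewrite ?invr_gt0 ?nnegrE ?ltW.
have d1 := is_derive1_powR N^-1 u0.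
have d2 : is_derive (u `^ N^-1) 1 h (N * (p (u `^ N^-1) - h (u `^ N^-1)) / (u `^ N^-1)).
  by apply: dh; rewrite r0.
have d3 := @is_derive1_comp _ h (fun u : R => u `^ N^-1) _ _ _ d2 d1.
have d4 : is_derive u 1 G _ := is_deriveM (is_derive_id u 1) d3.
apply: is_derive_eq d4 _.
have -> : u `^ (N^-1 - 1) = u `^ N^-1 / u.
  by rewrite powRB ?powRr1 ?ltW// (gt_eqF u0) implybT.
rewrite /GRing.scale /=.
by field; rewrite !gt_eqF.
Qed.

Let G0 : G u @[u --> 0^'+] --> G 0.
Proof.
have G00 : G 0 = 0 * h 0 by rewrite /G !mul0r.
rewrite G00; apply: cvgM; first by apply: cvg_at_right_filter; exact: cvg_id.
by apply: (@cvg_comp _ _ _ (fun u : R => u `^ N^-1) h _ _ _ cvg_shrink0); exact: ch.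
Qed.

Let G1 : G u @[u --> 1^'-] --> G 1.
Proof.
apply: cvg_at_left_filter; apply: cvgM => //.
apply: continuous_comp; [exact: continuous_root|exact: ch].
Qed.

Let cf : {within `[0, 1], continuous (fun u => p (u `^ N^-1))}.
Proof.
apply/continuous_within_itvP => //; split.
- move=> u; rewrite in_itv/= => /andP[u0 _].
  by apply: continuous_comp; [exact: continuous_root|exact: cp].
- rewrite powR0; last by rewrite invr_eq0 gt_eqF.
  by apply: (@cvg_comp _ _ _ (fun u : R => u `^ N^-1) p _ _ _ cvg_shrink0); exact: cp.
- apply: cvg_at_left_filter.
  by apply: continuous_comp; [exact: continuous_root|exact: cp].
Qed.

Lemma radial_integral_ge0 : (forall r, 0 <= r <= 1 -> 0 <= p r) ->
  \int[U]_u p (shrink u) = h 1.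
Proof.
move=> p0; rewrite /Rintegral integral_uniform; last 2 first.
- apply/measurable_EFinP; apply: measurableT_comp measurable_shrink.
  exact: continuous_measurable_fun.
- by move=> u; rewrite lee_fin p0// shrink_ge0 shrink_le1.
have E : (\int[lebesgue_measure]_(u in `[0%R, 1%R]) (p (shrink u))%:E = (h 1)%:E)%E.
  transitivity (\int[lebesgue_measure]_(u in `[0%R, 1%R]) (p (u `^ N^-1))%:E)%E.
    apply: eq_integral => u; rewrite inE/= in_itv/= => u01.
    by rewrite /shrink clamp_id.
  rewrite (continuous_FTC2 (F := G))//.
  - by rewrite /= /G powR1 mul1r mul0r sube0.
  - by split=> // u; rewrite in_itv/= => /dG[].
  - move=> u; rewrite in_itv/= => /dG[_ <-].
    by rewrite derive1E.
by rewrite subr0 invr1 mul1e; exact: (congr1 fine E).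
Qed.

End ftc.

Lemma bounded_mfun_shrink (p : R -> R) : continuous p ->
  bounded_mfun (fun u : measurableTypeR R => p (shrink u)).
Proof.
move=> cp.
have cp01 : {within `[0, 1], continuous p} by exact: continuous_subspaceT.
have [c _ hc] := EVT_min ler01 cp01; have [c' _ hc'] := EVT_max ler01 cp01.
split.
  by apply: measurableT_comp measurable_shrink; exact: continuous_measurable_fun.
exists (`|p c| + `|p c'|) => u.
have u01 : 0 <= shrink u <= 1 by rewrite shrink_ge0 shrink_le1.
have := hc (shrink u); have := hc' (shrink u); rewrite in_itv/= => /(_ u01) h1 /(_ u01) h2.
have := normr_ge0 (p c'); have := ler_norm (p c'); have := normr_ge0 (p c).
have := ler_norm (- p c); rewrite normrN ler_norml => ? ? ? ?.
by apply/andP; split; lra.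
Qed.

(** Adding the same constant to [p] and [h] preserves the equation and shifts both sides equally.
    The constant |min p| makes [p] nonnegative on [0, 1], the case already treated. *)
Lemma radial_integral (h p : R -> R) : continuous h -> continuous p ->
  (forall r : R, 0 < r < 1 -> is_derive r 1 h (N * (p r - h r) / r)) ->
  \int[U]_u p (shrink u) = h 1.
Proof.
move=> ch cp dh.
have cp01 : {within `[0, 1], continuous p} by exact: continuous_subspaceT.
have [c _ hc] := EVT_min ler01 cp01.
pose B := `|p c|.
have := @radial_integral_ge0 (fun r => h r + B) (fun r => p r + B).
rewrite meanD ?mean_cst//; [|exact: bounded_mfun_shrink|exact: bounded_mfun_cst].
move=> H; apply: (addIr B); apply: H => //.
- by move=> r; apply: cvgD; [exact: ch|exact: cvg_cst].
- by move=> r; apply: cvgD; [exact: cp|exact: cvg_cst].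
- move=> r r01; have d1 := dh r r01.
  have d2 : is_derive r 1 (fun r => h r + B) _ := is_deriveD d1 (is_derive_cst B r 1).
  by apply: is_derive_eq d2 _; rewrite addr0; congr (_ / _); ring.
- move=> r r01; have := hc r; rewrite in_itv/= => /(_ r01) pc.
  by rewrite -lerBlDr sub0r; apply: le_trans pc; rewrite lerNl /B -normrN ler_norm.
Qed.

(** For p(r) = r the radial equation is solved by h(r) = c r exactly when c = N / (N + 1). This is
    the contraction factor of [walk_mean_near]. *)
Lemma mean_shrink : \int[U]_u shrink u = N / (N + 1).
Proof.
rewrite -[RHS]mulr1.
apply: (radial_integral (h := fun r => N / (N + 1) * r) (p := fun r => r)).
- by move=> r; apply: cvgM; [exact: cvg_cst|exact: cvg_id].
- by move=> r; exact: cvg_id.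
move=> r /andP[r0 _].
have d : is_derive r 1 (fun r => N / (N + 1) * r) _ := is_deriveZ (N / (N+1)) (is_derive_id r 1).
apply: is_derive_eq d _; rewrite /GRing.scale/=; field.
by rewrite gt_eqF//= gt_eqF// addr_gt0.
Qed.

End radial.

(** * The random walk *)

Section dot_linear.
Context (R : realType) (n : nat).
Implicit Types u v w : 'rV[R]_n.

Lemma dotC u v : dot u v = dot v u.
Proof. by apply: eq_bigr => i _; rewrite mulrC. Qed.

Lemma dotDr u v w : dot u (v + w) = dot u v + dot u w.
Proof. by rewrite -big_split; apply: eq_bigr => i _; rewrite mxE mulrDr. Qed.

Lemma dotZr u c v : dot u (c *: v) = c * dot u v.
Proof. by rewrite mulr_sumr; apply: eq_bigr => i _; rewrite mxE mulrCA. Qed.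

End dot_linear.

Section walk.
Context (R : realType) (n : nat) (N : R) (N0 : 0 < N).
Local Notation V := 'rV[R]_n.
Local Notation U := (unit_uniform R).
Local Notation M := (measurableTypeR R).
Variables (P : seq V) (q : V -> V -> R -> R) (x : V).

(** From time [t] down to [s] the walk rests at [o], contributing (t - s) o; then a reflection is
    drawn with the weights at time [s], or none. Once the [m] steps are used up, all the time left
    is charged to [x]. The first half of the digits of [w] gives the time, and the other half [w1]
    is split again into the draw and the digits [w2] of the later steps. *)
Fixpoint walk (m : nat) (o : V) (t w : R) : V :=
  if m is m'.+1 then
    let s := t * shrink N (even_digits w) in
    let w1 := even_digits (doubling w) in
    let w2 := even_digits (doubling w1) in
    (t - s) *: o + select (fun a => q a o s)
      (fun a => walk m' (reflection a o) s w2) (walk m' o s w2) P (even_digits w1)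
  else t *: x.

(** The times are drawn independently of the jumps, so the time left after [m] steps is a function
    of the digits alone. *)
Fixpoint left_time (m : nat) (t w : R) : R :=
  if m is m'.+1 then
    left_time m' (t * shrink N (even_digits w)) (even_digits (doubling (even_digits (doubling w))))
  else t.

Hypothesis mq : forall a o, measurable_fun setT (q a o).

Lemma measurable_walk m o i :
  measurable_fun setT (fun p : M * M => walk m o p.1 p.2 0 i).
Proof.
elim: m o => [|m IH] o /=.
  rewrite (_ : (fun _ => _) = fun p : M * M => p.1 * x 0 i); last first.
    by apply/funext => p; rewrite mxE.
  by apply: measurable_funM => //; exact: measurable_fst.
have me : measurable_fun setT (fun p : M * M => even_digits p.2).
  exact: (measurableT_comp (@measurable_even_digits R) measurable_snd).
have msh : measurable_fun setT (fun p : M * M => even_digits (doubling p.2)).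
  exact: (measurableT_comp (@measurable_even_digits R)
    (measurableT_comp (@measurable_doubling R) measurable_snd)).
have mes : measurable_fun setT (fun y : R => even_digits (doubling y)).
  exact: (measurableT_comp (@measurable_even_digits R) (@measurable_doubling R)).
have ms : measurable_fun setT (fun p : M * M => p.1 * shrink N (even_digits p.2)).
  apply: measurable_funM; first exact: measurable_fst.
  exact: (measurableT_comp (measurable_shrink N) me).
rewrite (_ : (fun _ => _) = fun p : M * M =>
    (p.1 - p.1 * shrink N (even_digits p.2)) * o 0 i +
    select (fun a => q a o (p.1 * shrink N (even_digits p.2)))
      (fun a => walk m (reflection a o) (p.1 * shrink N (even_digits p.2))
         (even_digits (doubling (even_digits (doubling p.2)))) 0 i)
      (walk m o (p.1 * shrink N (even_digits p.2))
         (even_digits (doubling (even_digits (doubling p.2)))) 0 i)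
      P (even_digits (even_digits (doubling p.2)))); last first.
  apply/funext => p.
  by rewrite !mxE (select_map (fun y : V => y 0 i)).
apply: measurable_funD.
  apply: measurable_funM => //; apply: measurable_funB => //; exact: measurable_fst.
have mw a : measurable_fun setT (fun p : M * M =>
    walk m a (p.1 * shrink N (even_digits p.2))
         (even_digits (doubling (even_digits (doubling p.2)))) 0 i).
  have mpair : measurable_fun setT (fun p : M * M =>
      (p.1 * shrink N (even_digits p.2) : M,
       even_digits (doubling (even_digits (doubling p.2))) : M)).
    by apply: measurable_fun_pair => //; exact: (measurableT_comp mes msh).
  exact: (measurableT_comp (IH a) mpair).
apply: measurable_select => [a|a||] //.
  exact: (measurableT_comp (mq a o) ms).
exact: (measurableT_comp (@measurable_even_digits R) msh).
Qed.

Variable O : set V.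
Hypothesis O_refl : forall a o, a \in P -> O o -> O (reflection a o).
Hypothesis Ox : O x.

Lemma left_time_ge0 m t w : 0 <= t -> 0 <= left_time m t w.
Proof.
by elim: m t w => //= m IH t w t0; apply: IH; rewrite mulr_ge0// shrink_ge0.
Qed.

Lemma left_time_decr m t w : 0 <= t -> left_time m.+1 t w <= left_time m t w.
Proof.
elim: m t w => [|m IH] t w t0; first by rewrite /= ler_piMr// shrink_le1.
by apply: IH; rewrite mulr_ge0// shrink_ge0.
Qed.

(** One more step only refines the last piece: [x] is replaced by the current orbit point during the
    time of that step. The bound telescopes in [m]. *)
Lemma walk_increment i C : (forall o, O o -> `|o 0 i - x 0 i| <= C) ->
  forall m o t w, O o -> 0 <= t ->
  `|walk m.+1 o t w 0 i - walk m o t w 0 i| <=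
    C * (left_time m t w - left_time m.+1 t w).
Proof.
move=> OC; elim=> [|m IH] o t w Oo t0.
  rewrite /=; set s := t * _.
  have ts : 0 <= t - s by rewrite subr_ge0 ler_piMr// shrink_le1.
  set S := select _ _ _ _ _.
  (* No step remains after this one, so every branch returns the same vector. *)
  have -> : S = s *: x by apply: (@select_ind R _ V (fun y => y = s *: x)).
  rewrite !mxE (_ : _ - _ = (t - s) * (o 0 i - x 0 i)); last by ring.
  by rewrite normrM ger0_norm// mulrC ler_wpM2r// OC.
have s0 : 0 <= t * shrink N (even_digits w) by rewrite mulr_ge0// shrink_ge0.
rewrite [walk m.+2 _ _ _]/= [in X in _ - X]/= !mxE opprD addrACA subrr add0r.
apply: (@select_ind2 R _ V V (fun y y' : V => `|y 0 i - y' 0 i| <= _)) => [a aP|].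
  exact: IH (O_refl aP Oo) s0.
exact: IH.
Qed.

(** By [walk_increment] the walk plus C times the time left is nonincreasing, and the walk minus it
    is nondecreasing. Hence the limit exists for every [w], not merely almost surely. *)
Lemma cvg_walk i : (exists C, forall o, O o -> `|o 0 i - x 0 i| <= C) ->
  forall o t w, O o -> 0 <= t -> cvgn (fun m => walk m o t w 0 i).
Proof.
move=> [C OC] o t w Oo t0.
have cl : cvgn (fun m => left_time m t w).
  apply: nonincreasing_is_cvgn.
    by apply/nonincreasing_seqP => m; exact: left_time_decr.
  by exists 0 => _ [m _ <-]; exact: left_time_ge0.
have C0 : 0 <= C by apply: le_trans (OC _ Ox); exact: normr_ge0.
have incr m := walk_increment OC m w Oo t0.
have cu : cvgn (fun m => walk m o t w 0 i + C * left_time m t w).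
  apply: nonincreasing_is_cvgn.
    apply/nonincreasing_seqP => m.
    by have := incr m; rewrite ler_norml mulrBr => /andP[_]; lra.
  exists (walk 0 o t w 0 i - C * left_time 0 t w) => _ [m _ <-].
  have lm : 0 <= C * left_time m t w by rewrite mulr_ge0// left_time_ge0.
  suff : walk 0 o t w 0 i - C * left_time 0 t w <= walk m o t w 0 i - C * left_time m t w by lra.
  elim: m {lm} => // m; move/le_trans; apply.
  by have := incr m; rewrite ler_norml mulrBr => /andP[+ _]; lra.
rewrite (_ : (fun m => _) = (fun m => (walk m o t w 0 i + C * left_time m t w) -
    C * left_time m t w)); last by apply/funext => m; rewrite addrK.
by apply: is_cvgB => //; apply: is_cvgM => //; exact: is_cvg_cst.
Qed.

Variable H : set V.
Hypothesis OH : O `<=` H.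
Hypothesis H_convex : forall h1 h2 r, 0 <= r <= 1 -> H h1 -> H h2 ->
  H ((1 - r) *: h1 + r *: h2).

(** A step spends the fraction 1 - r of the time at [o] and the fraction r on the rest, so the walk
    divided by [t] is again a convex combination. *)
Lemma walk_convex m o t w : O o -> 0 <= t -> exists2 h, H h & walk m o t w = t *: h.
Proof.
elim: m o t w => [|m IH] o t w Oo t0 /=; first by exists x => //; exact: OH.
set r := shrink N (even_digits w); set s := t * r.
have s0 : 0 <= s by rewrite mulr_ge0// shrink_ge0.
set S := select _ _ _ _ _.
have [h Hh ->] : exists2 h, H h & S = s *: h.
  apply: (@select_ind R _ V (fun y : V => exists2 h, H h & y = s *: h)) => [a aP|].
    exact: IH (O_refl aP Oo) s0.
  exact: IH.
exists ((1 - r) *: o + r *: h).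
  by apply: H_convex => //; [rewrite shrink_ge0 shrink_le1|exact: OH].
by rewrite scalerDr !scalerA mulrBr mulr1.
Qed.

Variables (sa sb : V) (K : R).
Hypothesis HK : forall h, H h -> `|dot sa h| <= K.

(** The real part of e^(i phi + <s, y>) for s = sa + i sb. The free phase makes the family stable
    under translation of [y], as [waveD] shows. *)
Definition wave (phi : R) (y : V) : R := expR (dot sa y) * cos (phi + dot sb y).

Lemma waveD phi c o y : wave phi (c *: o + y) =
  expR (c * dot sa o) * wave (phi + c * dot sb o) y.
Proof. by rewrite /wave !dotDr !dotZr expRD -mulrA addrA. Qed.

Lemma wave_walk_le m o t w phi : O o -> 0 <= t -> `|wave phi (walk m o t w)| <= expR (K * t).
Proof.
move=> Oo t0; have [h Hh ->] := walk_convex m w Oo t0.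
rewrite /wave normrM ger0_norm ?expR_ge0// dotZr.
apply: (@le_trans _ _ (expR (t * dot sa h) * 1)).
  by rewrite ler_wpM2l ?expR_ge0// ler_norml cos_geN1 cos_le1.
rewrite mulr1 ler_expR mulrC ler_wpM2r//.
by apply: le_trans (ler_norm _) _; exact: HK.
Qed.

Definition walk_mean (m : nat) (o : V) (t phi : R) : R :=
  \int[U]_w wave phi (walk m o t w).

Definition jump_avg (o : V) (s : R) (D : V -> R) : R :=
  D o + \sum_(a <- P) q a o s * (D (reflection a o) - D o).

(** The Feynman-Kac step for given [u]: the potential <s, o> accumulated between the times [s] and
    [t] acts by its real part as a factor and by its imaginary part as a shift of the phase.
    [jump_avg] is the mean over the draw. *)
Definition step_integrand (F : V -> R -> R -> R) (o : V) (t phi u : R) : R :=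
  let s := t * shrink N u in
  expR ((t - s) * dot sa o) * jump_avg o s (fun o' => F o' s (phi + (t - s) * dot sb o)).


Lemma measurable_wave d (T : measurableType d) (f : T -> V) phi :
  (forall i, measurable_fun setT (fun t => f t 0 i)) ->
  measurable_fun setT (fun t => wave phi (f t)).
Proof.
move=> mf.
have md (s : V) : measurable_fun setT (fun t => dot s (f t)).
  by apply: measurable_sum => i; apply: measurable_funM.
apply: measurable_funM; first exact: (measurableT_comp (@measurable_expR R) (md sa)).
have mc : measurable_fun setT (@cos R).
  exact: continuous_measurable_fun (@continuous_cos R).
apply: (measurableT_comp mc); apply: measurable_funD => //; exact: md.
Qed.

Hypothesis q_ge0 : forall a o s, a \in P -> O o -> 0 <= s <= 1 -> 0 <= q a o s.
Hypothesis q_le1 : forall o s, O o -> 0 <= s <= 1 -> weight_sum (fun a => q a o s) P <= 1.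

Lemma shrink_time t u : 0 <= t <= 1 -> 0 <= t * shrink N u <= t.
Proof.
by move=> /andP[t0 t1]; rewrite mulr_ge0 ?shrink_ge0// ler_piMr// shrink_le1.
Qed.

Lemma mean_wave_select m o t phi u : O o -> 0 <= t <= 1 ->
  let s := t * shrink N u in
  \int[U]_w1 wave phi ((t - s) *: o + select (fun a => q a o s)
      (fun a => walk m (reflection a o) s (even_digits (doubling w1)))
      (walk m o s (even_digits (doubling w1))) P (even_digits w1)) =
  step_integrand (walk_mean m) o t phi u.
Proof.
move=> Oo t01 s.
have /andP[s0 st] : 0 <= s <= t := shrink_time u t01.
have s01 : 0 <= s <= 1 by rewrite s0 (le_trans st)//; case/andP: t01.
pose phi' := phi + (t - s) * dot sb o.
pose A a w2 := wave phi' (walk m (reflection a o) s w2).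
pose A0 w2 := wave phi' (walk m o s w2).
have bwalk o' : O o' -> bounded_mfun (fun w2 : M => wave phi' (walk m o' s w2)).
  move=> Oo'; split; last by exists (expR (K * s)) => w2; exact: wave_walk_le.
  apply: measurable_wave => i.
  have mp : measurable_fun setT (fun w2 : M => (s : M, w2)) by exact: measurable_pair1.
  exact: (measurableT_comp (measurable_walk m o' i) mp).
pose sel v w2 := select (fun a => q a o s) (A^~ w2) (A0 w2) P v.
(* Read as a draw among functions of [w2], so that [select_map] can later move the integral over
   [w2] inside the draw. *)
have selE v w2 : sel v w2 = select (fun a => q a o s) A A0 P v w2.
  by rewrite /sel (select_map (fun f : R -> R => f w2)).
have sel_eq v w2 : wave phi' (select (fun a => q a o s)
    (fun a => walk m (reflection a o) s w2) (walk m o s w2) P v) = sel v w2.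
  by rewrite (select_map (wave phi')).
have msel : measurable_fun setT (fun p : M * M => sel p.1 p.2).
  have mA a : measurable_fun setT (fun p : M * M => A a p.2).
    apply: measurable_wave => i.
    have mp : measurable_fun setT (fun p : M * M => (s : M, p.2)).
      by apply: measurable_fun_pair => //; exact: measurable_snd.
    exact: (measurableT_comp (measurable_walk m (reflection a o) i) mp).
  have mA0 : measurable_fun setT (fun p : M * M => A0 p.2).
    apply: measurable_wave => i.
    have mp : measurable_fun setT (fun p : M * M => (s : M, p.2)).
      by apply: measurable_fun_pair => //; exact: measurable_snd.
    exact: (measurableT_comp (measurable_walk m o i) mp).
  apply: (@measurable_select _ _ _ _ (fun=> fun a => q a o s) (fun p a => A a p.2)
    (fun p => A0 p.2) P (fun p => p.1)) => //; exact: measurable_fst.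
have sel_le v w2 : `|sel v w2| <= expR (K * s).
  apply: (@select_ind R _ R (fun y => `|y| <= _)) => [a aP|]; last exact: wave_walk_le.
  exact: (wave_walk_le _ _ _ (O_refl aP Oo)).
pose g (p : M * M) := sel p.1 p.2.
have bsel : bounded_mfun g.
  by split=> //; exists (expR (K * s)) => p; exact: sel_le.
transitivity (\int[U]_w1 (expR ((t - s) * dot sa o) * g (split_digits w1))).
  by apply: eq_Rintegral => w1 _; rewrite waveD -/phi' sel_eq.
rewrite meanZl; last first.
  have [ms [B sB]] := bsel; split; last by exists B => w1; exact: sB.
  exact: (measurableT_comp ms (@measurable_split_digits R)).
rewrite mean_split// /step_integrand -/s; congr (_ * _).
rewrite /jump_avg -mean_select; [|by move=> a aP; exact: q_ge0|exact: q_le1].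
apply: eq_Rintegral => v _ /=.
under eq_Rintegral do rewrite /g /= selE.
by rewrite (select_map (fun f : R -> R => \int[U]_w2 f w2)).
Qed.

(** The Markov property at the first step: the digits giving its time are independent of all the
    others, by [mean_split]. *)
Lemma walk_mean_step m o t phi : O o -> 0 <= t <= 1 ->
  bounded_mfun (step_integrand (walk_mean m) o t phi) /\
  walk_mean m.+1 o t phi = \int[U]_u step_integrand (walk_mean m) o t phi u.
Proof.
move=> Oo t01.
pose s u := t * shrink N u.
pose f (p : M * M) := wave phi ((t - s p.1) *: o + select (fun a => q a o (s p.1))
      (fun a => walk m (reflection a o) (s p.1) (even_digits (doubling p.2)))
      (walk m o (s p.1) (even_digits (doubling p.2))) P (even_digits p.2)).
have ms : measurable_fun setT (fun p : M * M => s p.1).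
  apply: measurable_funM => //.
  exact: (measurableT_comp (measurable_shrink N) measurable_fst).
have bf : bounded_mfun f.
  split.
    apply: measurable_wave => i.
    rewrite (_ : (fun _ => _) = fun p : M * M => (t - s p.1) * o 0 i +
      select (fun a => q a o (s p.1))
      (fun a => walk m (reflection a o) (s p.1) (even_digits (doubling p.2)) 0 i)
      (walk m o (s p.1) (even_digits (doubling p.2)) 0 i) P (even_digits p.2)); last first.
      by apply/funext => p; rewrite !mxE (select_map (fun y : V => y 0 i)).
    apply: measurable_funD.
      by apply: measurable_funM => //; apply: measurable_funB.
    have mes : measurable_fun setT (fun p : M * M => even_digits (doubling p.2)).
      exact: (measurableT_comp (@measurable_even_digits R)
        (measurableT_comp (@measurable_doubling R) measurable_snd)).
    have mw a : measurable_fun setT (fun p : M * M =>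
        walk m a (s p.1) (even_digits (doubling p.2)) 0 i).
      have mp : measurable_fun setT (fun p : M * M =>
          (s p.1 : M, even_digits (doubling p.2) : M)) by apply: measurable_fun_pair.
      exact: (measurableT_comp (measurable_walk m a i) mp).
    apply: measurable_select => [a|a||] //.
      exact: (measurableT_comp (mq a o) ms).
    exact: (measurableT_comp (@measurable_even_digits R) measurable_snd).
  exists (expR (K * t)) => -[u w1]; rewrite /f /= waveD normrM ger0_norm ?expR_ge0//.
  have /andP[s0 st] : 0 <= s u <= t := shrink_time u t01.
  have -> : K * t = K * (t - s u) + K * s u by ring.
  rewrite expRD ler_pM ?expR_ge0//.
    rewrite ler_expR mulrC ler_wpM2r ?subr_ge0//.
    by apply: le_trans (ler_norm _) _; exact/HK/OH.
  apply: (@select_ind R _ V (fun y => `|wave _ y| <= _)) => [a aP|].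
    exact: (wave_walk_le _ _ _ (O_refl aP Oo)).
  exact: wave_walk_le.
have fE u : \int[U]_w1 f (u, w1) = step_integrand (walk_mean m) o t phi u.
  exact: mean_wave_select.
split.
  have := bounded_mfun_partial U bf.
  by under eq_fun do rewrite fE.
transitivity (\int[U]_w f (split_digits w)); first by apply: eq_Rintegral.
by rewrite mean_split//; apply: eq_Rintegral => u _; exact: fE.
Qed.

Variable F : V -> R -> R -> R.
Hypothesis F_step : forall o t phi, O o -> 0 <= t <= 1 ->
  bounded_mfun (step_integrand F o t phi) /\
  F o t phi = \int[U]_u step_integrand F o t phi u.
Hypothesis K_ge0 : 0 <= K.

(** [jump_avg] is an average, with weights q a for the reflections and 1 minus their sum for
    staying, so it does not increase a uniform distance. *)
Lemma jump_avg_le o s (D D' : V -> R) B : O o -> 0 <= s <= 1 ->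
  (forall o', O o' -> `|D o' - D' o'| <= B) ->
  `|jump_avg o s D - jump_avg o s D'| <= B.
Proof.
move=> Oo s01 DB.
have -> : jump_avg o s D - jump_avg o s D' =
    (1 - weight_sum (fun a => q a o s) P) * (D o - D' o) +
    \sum_(a <- P) q a o s * (D (reflection a o) - D' (reflection a o)).
  have e : \sum_(a <- P) q a o s * (D (reflection a o) - D o) -
      \sum_(a <- P) q a o s * (D' (reflection a o) - D' o) =
      \sum_(a <- P) q a o s * (D (reflection a o) - D' (reflection a o)) -
      weight_sum (fun a => q a o s) P * (D o - D' o).
    by rewrite mulr_suml -!sumrB; apply: eq_bigr => a _; ring.
  rewrite /jump_avg opprD addrACA e; ring.
apply: le_trans (ler_normD _ _) _.
have -> : B = (1 - weight_sum (fun a => q a o s) P) * B + \sum_(a <- P) q a o s * B.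
  by rewrite -mulr_suml -/(weight_sum (fun a => q a o s) P); ring.
rewrite lerD//.
  rewrite normrM ger0_norm ?subr_ge0 ?q_le1// ler_wpM2l ?subr_ge0 ?q_le1//.
  exact: DB.
apply: le_trans (ler_norm_sum _ _ _) _; rewrite big_seq [leRHS]big_seq.
apply: ler_sum => a aP; rewrite normrM ger0_norm ?q_ge0// ler_wpM2l ?q_ge0//.
by apply: DB; exact: O_refl.
Qed.

(** Induction on [m], comparing the one-step equations of [F] and of the walk. The induction
    hypothesis at time s = t r contributes C t r, and the mean of r produces one more factor N / (N
    + 1). The growth of the potential is absorbed exactly, as e^(K (t - s)) e^(K s) = e^(K t). *)
Lemma walk_mean_near eps C : 0 <= eps -> 0 <= C ->
  (forall o t phi, O o -> 0 <= t <= 1 ->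
     `|F o t phi - wave phi (t *: x)| <= eps + C * t) ->
  forall m o t phi, O o -> 0 <= t <= 1 ->
  `|F o t phi - walk_mean m o t phi| <=
     (eps + C * (N / (N + 1)) ^+ m * t) * expR (K * t).
Proof.
move=> e0 C0 F0; set kappa := N / (N + 1).
have k0 : 0 <= kappa by rewrite divr_ge0// ?ltW// addr_gt0.
elim=> [|m IH] o t phi Oo t01; have /andP[t0 t1] := t01.
  rewrite /walk_mean /= mean_cst expr0 mulr1.
  apply: le_trans (F0 _ _ _ Oo t01) _; rewrite ler_peMr//.
    by rewrite addr_ge0// mulr_ge0.
  by rewrite -expR0 ler_expR mulr_ge0.
have [bF ->] := F_step phi Oo t01; have [bW ->] := walk_mean_step m phi Oo t01.
rewrite -meanB//.
pose B u := expR (K * t) * (eps + C * kappa ^+ m * t * shrink N u).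
have bs : bounded_mfun (fun u : M => shrink N u).
  split; first exact: measurable_shrink.
  by exists 1 => u; rewrite ger0_norm ?shrink_ge0// shrink_le1.
have bB' : bounded_mfun (fun u : M => eps + C * kappa ^+ m * t * shrink N u).
  by apply: bounded_mfunD; [exact: bounded_mfun_cst|
    apply: bounded_mfunM => //; exact: bounded_mfun_cst].
have bB : bounded_mfun B by apply: bounded_mfunM => //; exact: bounded_mfun_cst.
apply: (@le_trans _ _ (\int[U]_u B u)); last first.
  rewrite meanZl// meanD ?mean_cst//; last 2 first.
  - exact: bounded_mfun_cst.
  - by apply: bounded_mfunM => //; exact: bounded_mfun_cst.
  rewrite meanZl// mean_shrink// -/kappa mulrC.
  by rewrite ler_wpM2r ?expR_ge0// exprSr lerD2l le_eqVlt; apply/orP; left; apply/eqP; ring.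
apply: mean_norm_le => //; first exact: bounded_mfunB.
move=> u; rewrite /step_integrand.
have /andP[s0 st] := shrink_time u t01.
have s01 : 0 <= t * shrink N u <= 1 by rewrite s0 (le_trans st).
set s := t * shrink N u in s0 st s01 *.
rewrite -mulrBr normrM ger0_norm ?expR_ge0// /B.
have -> : K * t = K * (t - s) + K * s by ring.
rewrite expRD -mulrA; apply: ler_pM; rewrite ?expR_ge0//.
  rewrite ler_expR mulrC ler_wpM2r ?subr_ge0//.
  by apply: le_trans (ler_norm _) _; exact/HK/OH.
apply: jump_avg_le => // o' Oo'.
apply: le_trans (IH _ _ _ Oo' s01) _.
by rewrite mulrC -/s -(mulrA (C * _)).
Qed.

End walk.

(** * Uniqueness of Laplace transforms *)

Section laplace.
Context (R : realType) (n : nat).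
Local Notation V := (borel_rV R n).

Lemma mean_support d (T : measurableType d) (Q : probability T R) (H : set T) (f : T -> R) :
  measurable H -> Q (~` H) = 0%E -> measurable_fun setT f ->
  \int[Q]_y f y = \int[Q]_y (f y * \1_H y).
Proof.
move=> mH QH mf; rewrite /Rintegral; congr fine; apply: ae_eq_integral => //.
- exact/measurable_EFinP.
- apply/measurable_EFinP; apply: measurable_funM => //; exact: measurable_indic.
- exists (~` H); split => //; first exact: measurableC.
  move=> y /= h Hy; apply: h => _; rewrite indicE mem_set//.
  by rewrite mulr1.
Qed.

Lemma measurable_dot (s : 'rV[R]_n) : measurable_fun setT (fun y : V => dot s y).
Proof.
by apply: measurable_sum => i; apply: measurable_funM => //; exact: measurable_coord.
Qed.

Lemma exp_series_cvg (z : R) : series (exp_coeff z) k @[k --> \oo] --> expR z.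
Proof. exact: is_cvg_series_exp_coeff. Qed.

Lemma exp_series_le (z : R) k : `|series (exp_coeff z) k| <= expR `|z|.
Proof.
apply: (@le_trans _ _ (series (exp_coeff `|z|) k)).
  rewrite -normed_series_exp_coeff /series /=; exact: ler_norm_sum.
apply: nondecreasing_cvgn_le; last exact: is_cvg_series_exp_coeff.
apply/nondecreasing_seqP => m; rewrite /series /= big_nat_recr//= lerDl.
by rewrite exp_coeff_ge0.
Qed.

Variables (Q1 Q2 : probability V R) (H : set V) (B : R).
Hypothesis mH : measurable H.
Hypothesis HB : forall y : 'rV[R]_n, H y -> forall i, `|y 0 i| <= B.
Hypothesis Q1H : Q1 (~` H) = 0%E.
Hypothesis Q2H : Q2 (~` H) = 0%E.
Hypothesis Q12 : forall s : 'rV[R]_n,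
  \int[Q1]_y expR (dot s y) = \int[Q2]_y expR (dot s y).

(* Closed under products with exponentials, unlike plain equality of integrals. *)
Definition laplace_equal (f : V -> R) :=
  [/\ measurable_fun setT f, exists C, forall y, H y -> `|f y| <= C &
   forall s : 'rV[R]_n, \int[Q1]_y (f y * expR (dot s y) * \1_H y) =
                        \int[Q2]_y (f y * expR (dot s y) * \1_H y)].

Lemma measurable_exp_dot (s : 'rV[R]_n) : measurable_fun setT (fun y : V => expR (dot s y)).
Proof. exact: (measurableT_comp (@measurable_expR R) (measurable_dot s)). Qed.

Lemma bounded_on_support (f : V -> R) C : measurable_fun setT f ->
  (forall y, H y -> `|f y| <= C) -> bounded_mfun (fun y => f y * \1_H y).
Proof.
move=> mf fC; split; first by apply: measurable_funM => //; exact: measurable_indic.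
exists (Num.max C 0) => y; rewrite indicE; case: (boolP (y \in H)) => [/set_mem Hy|_].
  by rewrite mulr1 le_max fC.
by rewrite mulr0 normr0 le_max lexx orbT.
Qed.

Lemma exp_dot_le (s : 'rV[R]_n) : exists C, forall y : V, H y -> `|expR (dot s y)| <= C.
Proof.
exists (expR (\sum_(i < n) `|s 0 i| * B)) => y Hy.
rewrite ger0_norm ?expR_ge0// ler_expR; apply: ler_sum => i _.
apply: le_trans (ler_norm _) _; rewrite normrM ler_wpM2l//.
exact: HB.
Qed.

Lemma bounded_exp_support (f : V -> R) (s : 'rV[R]_n) : measurable_fun setT f ->
  (exists C, forall y, H y -> `|f y| <= C) ->
  bounded_mfun (fun y => f y * expR (dot s y) * \1_H y).
Proof.
move=> mf [C fC]; have [D sD] := exp_dot_le s.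
apply: (@bounded_on_support _ (C * D)).
  by apply: measurable_funM => //; exact: measurable_exp_dot.
by move=> y Hy; rewrite normrM ler_pM// ?fC ?sD.
Qed.

Lemma laplace_equal1 : laplace_equal (fun=> 1).
Proof.
split; [exact: measurable_cst|by exists 1 => y _; rewrite normr1|move=> s].
under eq_Rintegral do rewrite mul1r.
under [RHS]eq_Rintegral do rewrite mul1r.
by rewrite -!mean_support//; exact: measurable_exp_dot.
Qed.

Lemma laplace_equalD f g : laplace_equal f -> laplace_equal g ->
  laplace_equal (fun y => f y + g y).
Proof.
move=> [mf [C fC] ef] [mg [D gD] eg]; split.
- exact: measurable_funD.
- exists (C + D) => y Hy; apply: le_trans (ler_normD _ _) _.
  by rewrite lerD ?fC ?gD.
- move=> s.
  have bf := bounded_exp_support s mf (ex_intro _ C fC).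
  have bg := bounded_exp_support s mg (ex_intro _ D gD).
  under eq_Rintegral do rewrite !mulrDl.
  under [RHS]eq_Rintegral do rewrite !mulrDl.
  by rewrite !meanD// ef eg.
Qed.

Lemma laplace_equalZ c f : laplace_equal f -> laplace_equal (fun y => c * f y).
Proof.
move=> [mf [C fC] ef]; split.
- by apply: measurable_funM.
- by exists (`|c| * C) => y Hy; rewrite normrM ler_wpM2l// fC.
- move=> s; have bf := bounded_exp_support s mf (ex_intro _ C fC).
  under eq_Rintegral do rewrite -!mulrA mulrA.
  under [RHS]eq_Rintegral do rewrite -!mulrA mulrA.
  under eq_Rintegral do rewrite -!mulrA (mulrA (f _)).
  under [RHS]eq_Rintegral do rewrite -!mulrA (mulrA (f _)).
  by rewrite !meanZl// ef.
Qed.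

Lemma laplace_equal_exp t f : laplace_equal f ->
  laplace_equal (fun y => f y * expR (dot t y)).
Proof.
move=> [mf [C fC] ef]; split.
- by apply: measurable_funM => //; exact: measurable_exp_dot.
- have [D tD] := exp_dot_le t.
  by exists (C * D) => y Hy; rewrite normrM ler_pM// ?fC ?tD.
- move=> s; have e y : f y * expR (dot t y) * expR (dot s y) * \1_H y =
      f y * expR (dot (t + s) y) * \1_H y.
    by rewrite (dotC (t + s)) dotDr expRD !(dotC y) !mulrA.
  under eq_Rintegral do rewrite e.
  under [RHS]eq_Rintegral do rewrite e.
  exact: ef.
Qed.

Lemma laplace_equal_sum (I : Type) (r : seq I) (f : I -> V -> R) :
  (forall i, laplace_equal (f i)) -> laplace_equal (fun y => \sum_(i <- r) f i y).
Proof.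
move=> ef; elim: r => [|i r IH].
  under eq_fun do rewrite big_nil -[0](mul0r 1).
  exact: laplace_equalZ laplace_equal1.
by under eq_fun do rewrite big_cons; exact: laplace_equalD.
Qed.

Variable a : 'I_n -> R.

(* exp (- bump k) tends to the indicator of the orthant below [a], and is a
   power series in exponentials. *)
Definition bump (k : nat) (y : V) : R :=
  \sum_(i < n) expR (k%:R ^+ 2 * (y 0 i - a i) - k%:R).

(** Each summand of [bump] is a constant times the exponential of k^2 y_i, that is, of a pairing
    with a multiple of a basis vector. *)
Lemma laplace_equal_bump k f : laplace_equal f -> laplace_equal (fun y => f y * bump k y).
Proof.
move=> ef; under eq_fun do rewrite /bump mulr_sumr.
apply: laplace_equal_sum => i.
have e y : f y * expR (k%:R ^+ 2 * (y 0 i - a i) - k%:R) =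
    expR (- k%:R ^+ 2 * a i - k%:R) *
    (f y * expR (dot (k%:R ^+ 2 *: delta_mx 0 i) y)).
  rewrite (_ : dot _ y = k%:R ^+ 2 * y 0 i).
    by rewrite mulrCA -expRD; congr (_ * expR _); ring.
  rewrite dotC dotZr; congr (_ * _).
  rewrite /dot (bigD1 i)//= mxE !eqxx mulr1 big1 ?addr0// => j ji.
  by rewrite mxE (negbTE ji) andbF mulr0.
under eq_fun do rewrite e.
exact/laplace_equalZ/laplace_equal_exp.
Qed.

Lemma bump_ge0 k y : 0 <= bump k y.
Proof. by rewrite sumr_ge0// => i _; exact: expR_ge0. Qed.

Lemma laplace_equal_pow k j : laplace_equal (fun y => (- bump k y) ^+ j).
Proof.
elim: j => [|j IH]; first by under eq_fun do rewrite expr0; exact: laplace_equal1.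
under eq_fun do rewrite exprSr mulrN -mulN1r.
exact/laplace_equalZ/laplace_equal_bump.
Qed.

Lemma measurable_bump k : measurable_fun setT (bump k).
Proof.
have [+ _ _] := laplace_equal_bump k laplace_equal1.
by under eq_fun do rewrite mul1r.
Qed.

Lemma bump_bounded k : exists C, forall y, H y -> `|bump k y| <= C.
Proof.
have [_ + _] := laplace_equal_bump k laplace_equal1.
by move=> [C h]; exists C => y /h; rewrite mul1r.
Qed.

(** Partial sums of the exponential series are polynomials in [bump], on which the two integrals
    agree. Since [bump] is bounded by some [C] on [H], they are dominated there by e^C. *)
Lemma mean_exp_bump k :
  \int[Q1]_y (expR (- bump k y) * \1_H y) = \int[Q2]_y (expR (- bump k y) * \1_H y).
Proof.
pose S j (y : V) := series (exp_coeff (- bump k y)) j.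
have eS j : laplace_equal (S j).
  rewrite /S /series /=; apply: laplace_equal_sum => i.
  under eq_fun do rewrite /exp_coeff /= mulrC; apply: laplace_equalZ.
  exact: laplace_equal_pow.
have [C kC] := bump_bounded k.
have SC j y : `|S j y * \1_H y| <= expR C.
  rewrite indicE; case: (boolP (y \in H)) => [/set_mem Hy|_]; last first.
    by rewrite mulr0 normr0 expR_ge0.
  rewrite mulr1; apply: le_trans (exp_series_le _ _) _.
  by rewrite ler_expR normrN kC.
have Scvg y : S j y * \1_H y @[j --> \oo] --> expR (- bump k y) * \1_H y.
  by apply: cvgMr_tmp; exact: exp_series_cvg.
have mS j : measurable_fun setT (fun y => S j y * \1_H y).
  by have [mSj _ _] := eS j; apply: measurable_funM => //; exact: measurable_indic.
have c1 := @mean_cvg _ _ _ Q1 _ _ _ mS SC Scvg.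
have c2 := @mean_cvg _ _ _ Q2 _ _ _ mS SC Scvg.
have e12 j : \int[Q1]_y (S j y * \1_H y) = \int[Q2]_y (S j y * \1_H y).
  have [_ _ /(_ 0)] := eS j.
  have d0 (y : V) : expR (dot 0 y) = 1.
    by rewrite /dot big1 ?expR0// => i _; rewrite mxE mul0r.
  under eq_Rintegral do rewrite d0 mulr1.
  by under [X in _ = X -> _]eq_Rintegral do rewrite d0 mulr1.
rewrite (funext e12) in c1; exact: cvg_unique c1 c2.
Qed.

(** If y <= a, every exponent is at most - k, including at equality y_i = a_i: the term - k is what
    selects the closed orthant. If some y_i exceeds a_i, then k^2 outgrows k and [bump] is
    eventually at least k. *)
Lemma cvg_exp_bump (y : V) : expR (- bump k y) @[k --> \oo] -->
  (\1_[set y : V | forall i, y 0 i <= a i] y : R).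
Proof.
rewrite indicE; case: (boolP (y \in _)) => [/set_mem /= ya|/negP ya].
  have b0 : bump k y @[k --> \oo] --> (0 : R).
    apply: (@squeeze_cvgr _ _ _ _ (cst 0) (fun k : nat => n%:R * expR (- k%:R))).
    - near=> k; rewrite bump_ge0/=.
      apply: (@le_trans _ _ (\sum_(i < n) expR (- k%:R))); last first.
        by rewrite sumr_const card_ord mulr_natl.
      apply: ler_sum => i _; rewrite ler_expR gerDr.
      by rewrite mulr_ge0_le0 ?subr_le0// sqr_ge0.
    - exact: cvg_cst.
    - rewrite -[X in _ --> X](mulr0 n%:R); apply: cvgM; first exact: cvg_cst.
      exact: cvgn_expR.
  have -> : true%:R = expR (- 0) :> R by rewrite oppr0 expR0.
  apply: (@cvg_comp _ _ _ (fun k => - bump k y) (@expR R) _ _ _ (cvgN b0)).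
  exact: continuous_expR.
have [i yi] : exists i, a i < y 0 i.
  apply: contrapT => /forallNP h; apply: ya; rewrite inE /= => i.
  by rewrite leNgt; apply/negP; exact: h.
set d := y 0 i - a i; have d0 : 0 < d by rewrite subr_gt0.
apply: (@squeeze_cvgr _ _ _ _ (cst 0) (fun k : nat => expR (- k%:R))).
- near=> k; rewrite expR_ge0/= ler_expR lerN2.
  apply: (@le_trans _ _ (expR (k%:R ^+ 2 * d - k%:R))).
    apply: le_trans (expR_ge1Dx _).
    (* Then k^2 d - k >= k, and e^z >= 1 + z gives [bump] >= k. *)
    have kd : 2 <= k%:R * d.
      rewrite -ler_pdivrMr//; near: k; exact: nbhs_infty_ger.
    have k0 : 0 <= (k%:R : R) by [].
    have : k%:R * 2 <= k%:R * (k%:R * d) by rewrite ler_wpM2l.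
    by rewrite expr2 -mulrA; lra.
  by rewrite /bump (bigD1 i)//= lerDl sumr_ge0// => j _; exact: expR_ge0.
- exact: cvg_cst.
- exact: cvgn_expR.
Unshelve. all: by end_near. Qed.

Lemma mean_orthant (Q : probability V R) : Q (~` H) = 0%E ->
  \int[Q]_y (expR (- bump k y) * \1_H y) @[k --> \oo] -->
    fine (Q [set y : V | forall i, y 0 i <= a i]).
Proof.
move=> QH.
have mA : measurable [set y : V | forall i, y 0 i <= a i].
  apply: (@measurable_orthant _ V R _ (fun i (y : V) => y 0 i)) => i.
  exact: measurable_coord.
rewrite -mean_indic// (mean_support mH QH); last exact: measurable_indic.
apply: (mean_cvg (M := 1)).
- move=> k; apply: measurable_funM; last exact: measurable_indic.
  apply: (measurableT_comp (@measurable_expR R)).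
  exact: (measurableT_comp (@oppr_measurable R _) (measurable_bump k)).
- move=> k y; rewrite indicE; case: (y \in H) => /=; last by rewrite mulr0 normr0.
  by rewrite mulr1 ger0_norm ?expR_ge0// -expR0 ler_expR oppr_le0 bump_ge0.
- by move=> y; apply: cvgMr_tmp; exact: cvg_exp_bump.
Qed.

End laplace.

Lemma probability_eq_laplace (R : realType) (n : nat)
    (Q1 Q2 : probability (borel_rV R n) R) (H : set (borel_rV R n)) (B : R) :
  measurable H -> (forall y : 'rV[R]_n, H y -> forall i, `|y 0 i| <= B) ->
  Q1 (~` H) = 0%E -> Q2 (~` H) = 0%E ->
  (forall s : 'rV[R]_n, \int[Q1]_y expR (dot s y) = \int[Q2]_y expR (dot s y)) ->
  forall A, measurable A -> Q1 A = Q2 A.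
Proof.
move=> mH HB Q1H Q2H Q12; apply: probability_eq_rV => a.
have mA : measurable [set y : borel_rV R n | forall i, y 0 i <= a i].
  apply: (@measurable_orthant _ _ R _ (fun i (y : borel_rV R n) => y 0 i)) => i.
  exact: measurable_coord.
rewrite -[LHS]fineK ?fin_num_measure// -[RHS]fineK ?fin_num_measure//; congr EFin.
have c1 := mean_orthant mH HB Q1H Q2H Q12 (a := a) Q1H.
have c2 := mean_orthant mH HB Q1H Q2H Q12 (a := a) Q2H.
rewrite (funext (mean_exp_bump mH HB Q1H Q2H Q12 a)) in c1.
exact: cvg_unique c1 c2.
Qed.

(** * Weyl orbits and their convex hulls *)

Lemma continuous_sum (K : numFieldType) (T : topologicalType) (W : normedModType K)
    (I : Type) (r : seq I) (f : I -> T -> W) :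
  (forall i, continuous (f i)) -> continuous (fun t => \sum_(i <- r) f i t).
Proof.
move=> cf; elim: r => [|i r IH] t.
  by rewrite (_ : (fun _ => _) = cst 0);
    [exact: cvg_cst|apply/funext => t'; rewrite big_nil].
rewrite (_ : (fun _ => _) = fun t => f i t + \sum_(j <- r) f j t); last first.
  by apply/funext => t'; rewrite big_cons.
by apply: cvgD; [exact: cf|exact: IH].
Qed.

Section convexity.
Context (R : realType) (n : nat).
Local Notation V := 'rV[R]_n.

Lemma convex_setP (A : set V) : @convex_set R V A <->
  forall h1 h2 r, 0 <= r <= 1 -> A h1 -> A h2 -> A ((1 - r) *: h1 + r *: h2).
Proof.
split=> [cA h1 h2 r /andP[r0 r1] A1 A2|cA h1 h2 l].
  have := cA h2 h1 (Itv01 r0 r1); rewrite !inE => /(_ A2 A1).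
  by rewrite addrC.
rewrite !inE => A1 A2; rewrite /conv/= addrC.
by apply: cA => //; rewrite ge0 le1.
Qed.

Lemma sub_convex_hull (A : set V) : A `<=` convex_hull A.
Proof. exact: sub_gen_smallest. Qed.

Lemma convex_hull_sub (A B : set V) :
  (forall h1 h2 r, 0 <= r <= 1 -> B h1 -> B h2 -> B ((1 - r) *: h1 + r *: h2)) ->
  A `<=` B -> convex_hull A `<=` B.
Proof. by move=> cB AB; apply: smallest_sub => //; apply/convex_setP. Qed.

Lemma convex_hull_convex (A : set V) h1 h2 r : 0 <= r <= 1 ->
  convex_hull A h1 -> convex_hull A h2 -> convex_hull A ((1 - r) *: h1 + r *: h2).
Proof.
move=> r01 A1 A2 B [cB AB]; apply: (convex_setP B).1 => //.
  exact: A1.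
exact: A2.
Qed.

(** The weights are divided by their sum instead of being assumed to add up to 1, so that the
    induction can pass to the tail of the list. A tail of total weight 0 contributes nothing and is
    treated apart. *)
Lemma convex_comb (I : eqType) (l : seq I) (c : I -> R) (p : I -> V) (A : set V) :
  (forall h1 h2 r, 0 <= r <= 1 -> A h1 -> A h2 -> A ((1 - r) *: h1 + r *: h2)) ->
  (forall i, 0 <= c i) -> (forall i, A (p i)) ->
  0 < \sum_(i <- l) c i ->
  A ((\sum_(i <- l) c i)^-1 *: \sum_(i <- l) c i *: p i).
Proof.
move=> cA c0 pA; elim: l => [|i l IH]; first by rewrite big_nil ltxx.
rewrite !big_cons; set S := \sum_(j <- l) c j; set X := \sum_(j <- l) _.
have S0 : 0 <= S by apply: sumr_ge0.
have [S0'|] := boolP (S == 0).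
  have X0 : X = 0.
    rewrite /X; move: S0'; rewrite /S psumr_eq0 // => /allP cl.
    rewrite big_seq big1// => j jl; have /eqP -> := cl j jl.
    by rewrite scale0r.
  rewrite (eqP S0') X0 !addr0 => ci.
  by rewrite scalerA mulVf ?scale1r// gt_eqF.
move=> Sn0; have Sp : 0 < S by rewrite lt_def Sn0.
move=> cS; have -> : (c i + S)^-1 *: (c i *: p i + X) =
    (1 - S / (c i + S)) *: p i + (S / (c i + S)) *: (S^-1 *: X).
  rewrite scalerDr !scalerA; congr (_ *: _ + _ *: _); field; rewrite ?gt_eqF//.
apply: cA => //; last exact: IH.
apply/andP; split; first by apply: divr_ge0 => //; exact: ltW.
by rewrite ler_pdivrMr// mul1r lerDr c0.
Qed.

(** The hull is the image of the standard simplex, which is compact, under the continuous map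
    sending weights to the corresponding combination of the points of [L]. *)
Lemma convex_hull_finite (L : seq V) : compact (convex_hull [set y | y \in L]).
Proof.
pose m := size L.
pose S := [set c : 'rV[R]_m |
  (forall i, `[0, 1]%classic (c 0 i)) /\ \sum_i c 0 i = 1].
pose f (c : 'rV[R]_m) : V := \sum_i c 0 i *: L`_i.
have cS : compact S.
  have -> : S = [set c : 'rV[R]_m | forall i, `[0, 1]%classic (c 0 i)] `&`
      (fun c : 'rV[R]_m => \sum_i c 0 i) @^-1` [set 1] by [].
  apply: compact_closedI.
    exact: (@rV_compact R m (fun=> `[0, 1]%classic) (fun=> @segment_compact R 0 1)).
  apply: (preimage_closed _ (@closed_eq R 1)) => c _.
  apply: continuous_sum => i; exact: coord_continuous.
have cf : continuous f.
  apply: continuous_sum => i c.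
  apply: (@continuous_comp _ _ _ (fun c : 'rV[R]_m => c 0 i) (fun z : R => z *: L`_i)).
    exact: coord_continuous.
  exact: scalel_continuous.
suff -> : convex_hull [set y | y \in L] = f @` S.
  by apply: continuous_compact => //; exact: continuous_subspaceT.
apply/seteqP; split.
- apply: convex_hull_sub.
    move=> _ _ r /andP[r0 r1] [c1 [c1p c1s] <-] [c2 [c2p c2s] <-].
    exists ((1 - r) *: c1 + r *: c2).
      split=> [i|].
        rewrite !mxE /= !in_itv/=; have := c1p i; have := c2p i.
        rewrite /= !in_itv/= => /andP[? ?] /andP[? ?].
        by apply/andP; split; nra.
      under eq_bigr do rewrite !mxE.
      by rewrite big_split /= -!mulr_sumr c1s c2s; ring.
    rewrite /f !scaler_sumr -big_split; apply: eq_bigr => i _ /=.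
    by rewrite !mxE !scalerA -scalerDl.
  move=> y /= yL; have iy : (index y L < m)%N by rewrite index_mem.
  exists (delta_mx 0 (Ordinal iy)).
    split=> [i|]; first by rewrite mxE /= in_itv/= ler0n lern1 leq_b1.
    rewrite (bigD1 (Ordinal iy))//= mxE !eqxx big1 ?addr0// => j ji.
    by rewrite mxE (negbTE ji) andbF.
  rewrite /f (bigD1 (Ordinal iy))//= mxE !eqxx scale1r nth_index// big1 ?addr0// => j ji.
  by rewrite mxE (negbTE ji) andbF scale0r.
- move=> _ [c [cp cs] <-].
  have := @convex_comb _ (index_enum 'I_m) (fun i => c 0 i) (fun i => L`_i)
    (convex_hull [set y | y \in L]).
  rewrite cs invr1 scale1r; apply => //.
  + exact: convex_hull_convex.
  + by move=> i; have := cp i; rewrite /= in_itv/= => /andP[].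
  + by move=> i; apply: sub_convex_hull; exact: mem_nth.
Qed.

End convexity.

Section weyl_orbits.
Context (R : realType) (n : nat) (Phi : {fset 'rV[R]_n}).
Hypothesis hPhi : irreducible_root_system Phi.

Lemma reflection_linear (a u v : 'rV[R]_n) c :
  reflection a (c *: u + v) = c *: reflection a u + reflection a v.
Proof.
rewrite /reflection dotDr dotZr scalerBr scalerA addrACA -opprD -scalerDl.
by congr (_ - _ *: _); rewrite mulrDl; ring.
Qed.

Lemma reflection0 (a : 'rV[R]_n) : reflection a 0 = 0.
Proof.
rewrite /reflection (_ : dot a 0 = 0) ?mul0r ?mulr0 ?scale0r ?subr0//.
by rewrite /dot big1// => i _; rewrite mxE mulr0.
Qed.

Lemma reflectionZ (a u : 'rV[R]_n) c : reflection a (c *: u) = c *: reflection a u.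
Proof. by rewrite -[c *: u]addr0 reflection_linear reflection0 addr0. Qed.

Lemma weyl_group_sum w (I : Type) (r : seq I) (c : I -> R) (p : I -> 'rV[R]_n) :
  weyl_group Phi w -> w (\sum_(i <- r) c i *: p i) = \sum_(i <- r) c i *: w (p i).
Proof.
elim=> // a w' _ _ IH; rewrite /= IH.
elim: r {IH} => [|i r IH]; first by rewrite !big_nil reflection0.
by rewrite !big_cons reflection_linear IH.
Qed.

Lemma weyl_group_root w a : weyl_group Phi w -> a \in Phi -> w a \in Phi.
Proof.
move=> + aP; elim=> // b w' bP _ IH; exact: root_reflection hPhi _ _ bP IH.
Qed.

Lemma weyl_orbit_id x : weyl_orbit Phi x x.
Proof. by exists id => //; exact: weyl_id. Qed.

Lemma weyl_orbit_reflection a x o : a \in Phi -> weyl_orbit Phi x o ->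
  weyl_orbit Phi x (reflection a o).
Proof. by move=> aP [w hw ->]; exists (reflection a \o w) => //; exact: weyl_comp. Qed.

(* Roots span the space, so an element of the orbit is determined by the images
   of the roots. *)
Lemma weyl_orbit_finite x : exists L : seq 'rV[R]_n, weyl_orbit Phi x = [set y | y \in L].
Proof.
pose X := in_tuple (enum_fset Phi).
pose pt (g : {ffun 'I_(size Phi) -> 'I_(size Phi)}) : 'rV[R]_n :=
  \sum_i coord X i x *: X`_(g i).
exists [seq y <- codom pt | `[< weyl_orbit Phi x y >]].
apply/seteqP; split => y /=; last by rewrite mem_filter => /andP[/asboolP].
move=> yO; rewrite mem_filter; apply/andP; split; first exact/asboolP.
have [w hw ->] := yO.
(* The roots span but are not a basis. Some fixed choice of coefficients is enough: [w] keeps them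
   and moves only the roots, and [g] records where the roots go. *)
have xE : x = \sum_i coord X i x *: X`_i.
  by apply: coord_span; rewrite (root_span hPhi) memvf.
have wX (i : 'I_(size Phi)) : (index (w (X`_i)%R) (enum_fset Phi) < size Phi)%N.
  by rewrite index_mem; apply: weyl_group_root => //; exact: mem_nth.
apply/codomP; exists [ffun i => Ordinal (wX i)].
rewrite [in LHS]xE weyl_group_sum//; apply: eq_bigr => i _.
rewrite ffunE /= nth_index//; apply: weyl_group_root => //; exact: mem_nth.
Qed.

End weyl_orbits.

Section hull_geometry.
Context (R : realType) (n : nat) (L : seq 'rV[R]_n).
Local Notation H := (convex_hull [set y | y \in L]).

Lemma measurable_hull : @measurable _ (borel_rV R n) H.
Proof.
rewrite -[X in measurable X]setCK; apply: measurableC; apply: sub_sigma_algebra.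
apply: closed_openC; apply: compact_closed; first exact: norm_hausdorff.
exact: convex_hull_finite.
Qed.

Lemma seq_bound (g : 'rV[R]_n -> R) y : y \in L -> `|g y| <= \sum_(z <- L) `|g z|.
Proof. by move=> yL; rewrite (big_rem y)//= lerDl sumr_ge0. Qed.

(** A bound on the absolute value of a linear form defines a convex set, so it passes from the
    points of [L] to their hull. *)
Lemma hull_dot_bound (a : 'rV[R]_n) :
  exists2 K, 0 <= K & forall h, H h -> `|dot a h| <= K.
Proof.
exists (\sum_(z <- L) `|dot a z|); first exact: sumr_ge0.
apply: convex_hull_sub; last by move=> y /= /(seq_bound (dot a)).
move=> h1 h2 r /andP[r0 r1] A1 A2; rewrite dotDr !dotZr.
apply: le_trans (ler_normD _ _) _; rewrite !normrM (ger0_norm r0) ger0_norm ?subr_ge0//.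
have : (1 - r) * `|dot a h1| <= (1 - r) * \sum_(z <- L) `|dot a z|.
  by rewrite ler_wpM2l// subr_ge0.
have : r * `|dot a h2| <= r * \sum_(z <- L) `|dot a z| by rewrite ler_wpM2l.
lra.
Qed.

Lemma hull_coord_bound : exists B, forall h, H h -> forall i, `|h 0 i| <= B.
Proof.
have hB (i : 'I_n) : exists K, 0 <= K /\ forall h, H h -> `|h 0 i| <= K.
  have [K K0 HK] := hull_dot_bound (delta_mx 0 i); exists K; split => // h /HK.
  rewrite /dot (bigD1 i)//= mxE !eqxx mul1r big1 ?addr0// => j ji.
  by rewrite mxE (negbTE ji) andbF mul0r.
have [K HK] := boolp.choice hB.
exists (\sum_i K i) => h Hh i; apply: le_trans ((HK i).2 h Hh) _.
by rewrite (bigD1 i)//= lerDl sumr_ge0// => j _; exact: (HK j).1.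
Qed.

End hull_geometry.

(** * The kernel along a ray *)

Section jump_rate.
Context (R : realType).

(* v / (1 - exp (- v)) is nonnegative: this is what makes the operator along a
   ray a Markov generator. *)
Definition jump_rate (v : R) : R := if v == 0 then 1 else v / (1 - expR (- v)).

Lemma jump_rate_mul v : jump_rate v * (1 - expR (- v)) = v.
Proof.
rewrite /jump_rate; case: eqVneq => [->|v0]; first by rewrite oppr0 expR0 subrr mulr0.
rewrite divfK// subr_eq0 eq_sym -expR0; apply: contra_neq v0.
by move/expR_inj/eqP; rewrite oppr_eq0 => /eqP.
Qed.

(** Both bounds come from e^z >= 1 + z, at z = v and at z = - v. They give positivity and growth,
    and since both tend to 1 as v tends to 0 they also give continuity there. *)
Lemma jump_rate_bounds v :
  Num.min 1 (expR v) <= jump_rate v <= Num.max 1 (expR v).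
Proof.
rewrite /jump_rate; case: eqVneq => [->|v0]; first by rewrite expR0 minxx maxxx lexx.
have h1 : 1 - expR (- v) <= v by have := expR_ge1Dx (- v); lra.
have h2 : expR (- v) * v <= 1 - expR (- v).
  rewrite -[X in X - _](expRxMexpNx_1 v) mulrC -{3}[expR (- v)]mul1r -mulrBl.
  by rewrite ler_wpM2r ?expR_ge0//; have := expR_ge1Dx v; lra.
have h3 : v <= expR v * (1 - expR (- v)).
  have := ler_wpM2l (expR_ge0 v) h2.
  by rewrite mulrA expRxMexpNx_1 mul1r.
have [vp|vn|/eqP] := ltgtP v 0; last by rewrite (negbTE v0).
- have dn : 1 - expR (- v) < 0 by exact: le_lt_trans h1 vp.
  have e1 : expR v <= 1 by rewrite -expR0 ler_expR ltW.
  rewrite min_r// max_l// ler_ndivlMr// ler_ndivrMr// mul1r h1 andbT.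
  exact: h3.
- have dp : 0 < 1 - expR (- v).
    by apply: lt_le_trans h2; rewrite mulr_gt0 ?expR_gt0.
  have e1 : 1 <= expR v by rewrite -expR0 ler_expR ltW.
  rewrite min_l// max_r// ler_pdivlMr// ler_pdivrMr// mul1r h1/=.
  exact: h3.
Qed.

Lemma jump_rate_ge0 v : 0 <= jump_rate v.
Proof.
have /andP[h _] := jump_rate_bounds v; apply: le_trans h.
by rewrite le_min ler01 expR_ge0.
Qed.

Lemma jump_rate_le v : jump_rate v <= expR `|v|.
Proof.
have /andP[_ h] := jump_rate_bounds v; apply: le_trans h _.
by rewrite ge_max ler_expR ler_norm -[leLHS]expR0 ler_expR normr_ge0.
Qed.

Lemma continuous_jump_rate : continuous jump_rate.
Proof.
move=> v; have [->|v0] := eqVneq v 0.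
  rewrite /continuous_at {2}/jump_rate eqxx.
  apply/cvgrPdist_le => e e0.
  have : expR u @[u --> (0 : R)] --> expR 0 by exact: continuous_expR.
  rewrite expR0 => /cvgrPdist_le/(_ e e0); apply: filterS => u.
  have /andP[h1 h2] := jump_rate_bounds u; move: h1 h2.
  rewrite !ler_norml le_max ge_min => h1 h2 /andP[h3 h4].
  by move: h1 h2 => /orP[?|?] /orP[?|?]; apply/andP; split; lra.
have d0 : 1 - expR (- v) != 0.
  apply: contra v0 => /eqP d; have := jump_rate_mul v.
  by rewrite d mulr0 => <-.
have c : {for v, continuous (fun u : R => u / (1 - expR (- u)))}.
  apply: cvgM; first exact: cvg_id.
  apply: cvgV => //; apply: cvgB; first exact: cvg_cst.
  by apply: (@continuous_comp _ _ _ (@GRing.opp R) (@expR R));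
    [exact: oppr_continuous|exact: continuous_expR].
rewrite /continuous_at {2}/jump_rate (negbTE v0); apply: cvg_trans c.
apply: near_eq_cvg; near=> u; rewrite /jump_rate ifF//.
by apply/negbTE; near: u; exact: (cvgr_neq0 (f := fun u : R => u) v cvg_id v0).
Unshelve. all: by end_near. Qed.

End jump_rate.

Section complex_sums.
Context (R : realType).
Local Open Scope complex_scope.

Lemma Re_sum (I : Type) (r : seq I) (F : I -> R[i]) :
  complex.Re (\sum_(i <- r) F i) = \sum_(i <- r) complex.Re (F i).
Proof.
by elim: r => [|i r IH]; rewrite ?big_nil// !big_cons -IH;
  case: (F i) => ? ?; case: (\sum_(_ <- _) _).
Qed.

Lemma Im_sum (I : Type) (r : seq I) (F : I -> R[i]) :
  complex.Im (\sum_(i <- r) F i) = \sum_(i <- r) complex.Im (F i).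
Proof.
by elim: r => [|i r IH]; rewrite ?big_nil// !big_cons -IH;
  case: (F i) => ? ?; case: (\sum_(_ <- _) _).
Qed.

Lemma Re_realM (x : R) (z : R[i]) : complex.Re (x%:C * z) = x * complex.Re z.
Proof. by case: z => a b; rewrite /= mul0r subr0. Qed.

Lemma Im_realM (x : R) (z : R[i]) : complex.Im (x%:C * z) = x * complex.Im z.
Proof. by case: z => a b; rewrite /= mul0r addr0. Qed.

Lemma ReD (y z : R[i]) : complex.Re (y + z) = complex.Re y + complex.Re z.
Proof. by case: y z => ? ? [? ?]. Qed.
Lemma ImD (y z : R[i]) : complex.Im (y + z) = complex.Im y + complex.Im z.
Proof. by case: y z => ? ? [? ?]. Qed.
Lemma ReN (y : R[i]) : complex.Re (- y) = - complex.Re y.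
Proof. by case: y. Qed.
Lemma ImN (y : R[i]) : complex.Im (- y) = - complex.Im y.
Proof. by case: y. Qed.

End complex_sums.

Section kernel_ray.
Context (R : realType) (n : nat).
Local Open Scope complex_scope.
Variables (P : {fset 'rV[R]_n}) (k : 'rV[R]_n -> R) (s : 'rV[R[i]]_n).
Variable f : 'rV[R]_n -> R[i].
Hypothesis hf : opdam_cherednik_kernel P k (s - complexify (rho P k)) f.

Definition re_row : 'rV[R]_n := map_mx (@complex.Re R) s.
Definition im_row : 'rV[R]_n := map_mx (@complex.Im R) s.
Local Notation u := (fun y => complex.Re (f y)).
Local Notation v := (fun y => complex.Im (f y)).

Lemma dot_complexify (y : 'rV[R]_n) :
  dot s (complexify y) = (dot re_row y) +i* (dot im_row y).
Proof.
apply/eqP; rewrite eq_complex; apply/andP; split; apply/eqP => /=.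
  rewrite /dot Re_sum; apply: eq_bigr => i _.
  by rewrite !mxE mulrC Re_realM mulrC.
rewrite /dot Im_sum; apply: eq_bigr => i _.
by rewrite !mxE mulrC Im_realM mulrC.
Qed.

(** On the hyperplane <a, z> = 0 both sides vanish: the left by its coefficient, the right because
    the reflection fixes [z]. Off it, the factor r <a, z> missing from the numerator of [jump_rate]
    is paid for by 1/r. *)
Lemma dunkl_term (a z : 'rV[R]_n) (r : R) : 0 < r ->
  (k a * dot a z)%:C * divided_difference a f (r *: z) =
  (r^-1 * (k a * jump_rate (r * dot a z)))%:C * (f (r *: z) - f (r *: reflection a z)).
Proof.
move=> r0; have [az|az] := eqVneq (dot a z) 0.
  by rewrite az mulr0 mul0r /reflection az mul0r mulr0 scale0r subr0 subrr mulr0.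
rewrite /divided_difference dotZr mulf_eq0 gt_eqF//= (negbTE az) reflectionZ.
set X := f _ - f _; rewrite mulrCA mulrC -fmorphV -rmorphM; congr (_%:C * _).
rewrite /jump_rate mulf_eq0 gt_eqF//= (negbTE az).
set e := 1 - _; have e0 : e != 0.
  rewrite subr_eq0 eq_sym -expR0; apply: contra_neq az.
  by move/expR_inj/eqP; rewrite oppr_eq0 mulf_eq0 gt_eqF//= => /eqP.
by field; rewrite e0 gt_eqF.
Qed.

(** The operator is taken in the direction [z] of the ray. The term - <rho, z> f then stands on both
    sides, in the operator and in the shifted eigenvalue, and [addIr] cancels it. *)
Lemma kernel_ray_equation (z : 'rV[R]_n) (r : R) : 0 < r ->
  cderive z f (r *: z) = dot s (complexify z) * f (r *: z) +
    \sum_(a <- P) (r^-1 * (k a * jump_rate (r * dot a z)))%:C *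
      (f (r *: reflection a z) - f (r *: z)).
Proof.
move=> r0; have [_ /(_ z (r *: z)) + _] := hf.
rewrite /dunkl_cherednik.
rewrite (eq_bigr _ (fun a _ => dunkl_term a z r0)).
have -> : dot (s - complexify (rho P k)) (complexify z) =
    dot s (complexify z) - (dot (rho P k) z)%:C.
  move: (rho P k) => q; rewrite /dot rmorph_sum -sumrB; apply: eq_bigr => i _.
  by rewrite !mxE mulrBl /= rmorphM.
rewrite mulrBl => /addIr /(canRL (addrK _)) ->; congr (_ + _).
by rewrite -sumrN; apply: eq_bigr => a _; rewrite -mulrN opprB.
Qed.

Lemma kernel_ray_Re (z : 'rV[R]_n) (r : R) : 0 < r ->
  'D_z u (r *: z) = dot re_row z * u (r *: z) - dot im_row z * v (r *: z) +
    r^-1 * \sum_(a <- P) k a * jump_rate (r * dot a z) *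
      (u (r *: reflection a z) - u (r *: z)).
Proof.
move=> r0; have := congr1 (@complex.Re R) (kernel_ray_equation z r0).
rewrite /cderive [complex.Re (_ +i* _)]/= => ->; rewrite ReD Re_sum dot_complexify.
congr (_ + _); first by case: (f (r *: z)).
by rewrite mulr_sumr; apply: eq_bigr => a _; rewrite Re_realM ReD ReN !mulrA.
Qed.

Lemma kernel_ray_Im (z : 'rV[R]_n) (r : R) : 0 < r ->
  'D_z v (r *: z) = dot re_row z * v (r *: z) + dot im_row z * u (r *: z) +
    r^-1 * \sum_(a <- P) k a * jump_rate (r * dot a z) *
      (v (r *: reflection a z) - v (r *: z)).
Proof.
move=> r0; have := congr1 (@complex.Im R) (kernel_ray_equation z r0).
rewrite /cderive [complex.Im (_ +i* _)]/= => ->; rewrite ImD Im_sum dot_complexify.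
congr (_ + _); first by case: (f (r *: z)).
by rewrite mulr_sumr; apply: eq_bigr => a _; rewrite Im_realM ImD ImN !mulrA.
Qed.

Lemma is_derive_ray (g : 'rV[R]_n -> R) (z : 'rV[R]_n) (r : R) :
  differentiable g (r *: z) -> is_derive r 1 (fun r => g (r *: z)) ('D_z g (r *: z)).
Proof.
move=> dg; have dz : derivable g (r *: z) z by exact: diff_derivable.
have e : (fun h : R => h^-1 *: (((fun r => g (r *: z)) \o +%R^~ r) (h *: 1) - g (r *: z))) =
    (fun h : R => h^-1 *: ((g \o +%R^~ (r *: z)) (h *: z) - g (r *: z))).
  by apply/funext => h /=; rewrite scalerDl [h *: 1]mulr1.
apply: DeriveDef; first by rewrite /derivable e; exact: dz.
by rewrite /derive e.
Qed.

Lemma kernel_differentiable y : differentiable u y /\ differentiable v y.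
Proof. by have [/(_ 1) [[+ _] [+ _]] _ _] := hf; move=> /(_ y) ? /(_ y) ?. Qed.

Lemma kernel_continuous : continuous u /\ continuous v.
Proof. by have [/(_ 0) [? ?] _ _] := hf. Qed.

Lemma continuous_ray (g : 'rV[R]_n -> R) (z : 'rV[R]_n) :
  continuous g -> continuous (fun r : R => g (r *: z)).
Proof.
move=> cg r; apply: (@continuous_comp _ _ _ (fun r : R => r *: z) g); last exact: cg.
exact: scalel_continuous.
Qed.

End kernel_ray.

(** * The one-step equation for the kernel *)

Section kernel_step.
Context (R : realType) (n : nat) (N : R) (N0 : 0 < N).
Local Open Scope complex_scope.
Variables (P : {fset 'rV[R]_n}) (k : 'rV[R]_n -> R) (s : 'rV[R[i]]_n).
Variable f : 'rV[R]_n -> R[i].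
Hypothesis hf : opdam_cherednik_kernel P k (s - complexify (rho P k)) f.
Local Notation u := (fun y => complex.Re (f y)).
Local Notation v := (fun y => complex.Im (f y)).
Local Notation sa := (re_row s).
Local Notation sb := (im_row s).

(** The jump rate divided by the uniformizing rate [N]: the probability that a step of the clock is
    a jump along [a]. *)
Definition jump_weight (a o : 'rV[R]_n) (t : R) : R := k a * jump_rate (t * dot a o) / N.

(* The real part of [expR (i phi) * f (t o)]; the phase [phi] absorbs the
   imaginary part of the spectral parameter, so that only real integrals occur. *)
Definition rotated (o : 'rV[R]_n) (t phi : R) : R :=
  cos phi * u (t *: o) - sin phi * v (t *: o).

Lemma is_derive_phase (c t b r : R) :
  is_derive r 1 (fun r => c + (t - t * r) * b) (- (t * b)).
Proof.
have -> : (fun r => c + (t - t * r) * b) = cst (c + t * b) + (- (t * b)) \*: id.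
  by apply/funext => y; rewrite !fctE;
    change (c + (t - t * y) * b = c + t * b + - (t * b) * y); ring.
have := is_deriveD (is_derive_cst (c + t * b) r 1) (is_deriveZ (- (t * b)) (is_derive_id r 1)).
by rewrite add0r /GRing.scale/= mulr1.
Qed.

Lemma continuous_phase (c t b : R) : continuous (fun r => c + (t - t * r) * b).
Proof.
move=> r; have [d _] := is_derive_phase c t b r.
exact/differentiable_continuous/derivable1_diffP.
Qed.

Lemma continuous_rotated (o : 'rV[R]_n) (t phi b : R) :
  continuous (fun r => rotated o (t * r) (phi + (t - t * r) * b)).
Proof.
have [cu cv] := kernel_continuous hf.
have cr (g : 'rV[R]_n -> R) : continuous g -> continuous (fun r : R => g ((t * r) *: o)).
  move=> cg; rewrite (_ : (fun r : R => _) = (fun r : R => g (r *: (t *: o)))).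
    exact: continuous_ray.
  by apply/funext => r; rewrite scalerA mulrC.
move=> r; apply: cvgB; apply: cvgM; [|exact: (cr _ cu r)| |exact: (cr _ cv r)].
  apply: (@continuous_comp _ _ _ (fun r => phi + (t - t * r) * b) (@cos R)).
    exact: continuous_phase.
  exact: continuous_cos.
apply: (@continuous_comp _ _ _ (fun r => phi + (t - t * r) * b) (@sin R)).
  exact: continuous_phase.
exact: continuous_sin.
Qed.

Lemma continuous_jump_weight (a o : 'rV[R]_n) (t : R) :
  continuous (fun r => jump_weight a o (t * r)).
Proof.
move=> r; apply: cvgMr_tmp; apply: cvgMl_tmp.
apply: (@continuous_comp _ _ _ (fun r => t * r * dot a o) (@jump_rate R)).
  by apply: cvgMr_tmp; apply: cvgMl_tmp; exact: cvg_id.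
exact: continuous_jump_rate.
Qed.

(** The exponential and the moving phase form an integrating factor: their derivatives cancel the
    terms in <s, z> of the kernel equation, and only the jump terms remain. The [0 +] in the
    exponent makes it an instance of [is_derive_phase], like the phase itself. *)
Lemma rotated_derive (o : 'rV[R]_n) (t phi r : R) : 0 < r ->
  let h := fun r => expR (0 + (t - t * r) * dot sa o) *
    rotated o (t * r) (phi + (t - t * r) * dot sb o) in
  let p := fun r => expR (0 + (t - t * r) * dot sa o) *
    jump_avg P jump_weight o (t * r)
      (fun o' => rotated o' (t * r) (phi + (t - t * r) * dot sb o)) in
  is_derive r 1 h (N * (p r - h r) / r).
Proof.
move=> r0 h p; pose z := t *: o.
have dE := is_derive1_comp (is_derive_expR _) (is_derive_phase 0 t (dot sa o) r).
have dC := is_derive1_comp (is_derive_cos _) (is_derive_phase phi t (dot sb o) r).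
have dS := is_derive1_comp (is_derive_sin _) (is_derive_phase phi t (dot sb o) r).
have [du dv] := kernel_differentiable hf (r *: z).
have dU := is_derive_ray du; have dV := is_derive_ray dv.
have hE : h = (@expR R \o (fun r => 0 + (t - t * r) * dot sa o)) *
   (((@cos R \o (fun r => phi + (t - t * r) * dot sb o)) * (fun r => u (r *: z))) -
    ((@sin R \o (fun r => phi + (t - t * r) * dot sb o)) * (fun r => v (r *: z)))).
  by apply/funext => y; rewrite /h /rotated !fctE /= /z scalerA [y * t]mulrC.
rewrite hE; have dh := is_deriveM dE (is_deriveB (is_deriveM dC dU) (is_deriveM dS dV)).
apply: is_derive_eq dh _.
rewrite (kernel_ray_Re hf)// (kernel_ray_Im hf)// /p /h /jump_avg /= !fctE /=.
set S1 := \sum_(a <- P) _; set S2 := \sum_(a <- P) _; set S3 := \sum_(a <- P) _.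
set c := cos _; set d := sin _; set E := expR _.
(* The jump sums of the real and imaginary parts, rotated by the phase, are [N] times the jump part
   of [jump_avg]. *)
have e3 : N * S3 = c * S1 - d * S2.
  rewrite /S1 /S2 /S3 [N * _]mulr_sumr [c * _]mulr_sumr [d * _]mulr_sumr -sumrB;
    apply: eq_bigr => a _.
  rewrite /jump_weight /rotated -/c -/d.
  have -> : t * r * dot a o = r * dot a z by rewrite /z dotZr; ring.
  have -> : (t * r) *: reflection a o = r *: reflection a z.
    by rewrite /z reflectionZ scalerA mulrC.
  have -> : (t * r) *: o = r *: z by rewrite /z scalerA mulrC.
  by field; rewrite gt_eqF.
rewrite /rotated -/c -/d.
have -> : (t * r) *: o = r *: z by rewrite /z scalerA mulrC.
rewrite /z !dotZr -/z /GRing.scale /=.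
have -> : S3 = (c * S1 - d * S2) / N by rewrite -e3 mulrAC mulfV ?mul1r// gt_eqF.
by field; rewrite !gt_eqF.
Qed.

Lemma rotated_step (o : 'rV[R]_n) (t phi : R) :
  bounded_mfun (step_integrand N P jump_weight sa sb rotated o t phi) /\
  rotated o t phi =
    \int[unit_uniform R]_u step_integrand N P jump_weight sa sb rotated o t phi u.
Proof.
pose h := fun r => expR (0 + (t - t * r) * dot sa o) *
    rotated o (t * r) (phi + (t - t * r) * dot sb o).
pose p := fun r => expR (0 + (t - t * r) * dot sa o) *
    jump_avg P jump_weight o (t * r)
      (fun o' => rotated o' (t * r) (phi + (t - t * r) * dot sb o)).
have pE : step_integrand N P jump_weight sa sb rotated o t phi = fun u => p (shrink N u).
  by apply/funext => w; rewrite /p add0r.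
have cE : continuous (fun r => expR (0 + (t - t * r) * dot sa o)).
  move=> r; apply: (@continuous_comp _ _ _ (fun r => 0 + (t - t * r) * dot sa o) (@expR R)).
    exact: continuous_phase.
  exact: continuous_expR.
have ch : continuous h by move=> r; apply: cvgM; [exact: cE|exact: continuous_rotated].
have cp : continuous p.
  move=> r; apply: cvgM; first exact: cE.
  apply: cvgD; first exact: continuous_rotated.
  apply: (@continuous_sum R R R^o _ _ (fun a r => jump_weight a o (t * r) *
    (rotated (reflection a o) (t * r) (phi + (t - t * r) * dot sb o) -
     rotated o (t * r) (phi + (t - t * r) * dot sb o)))) => a r'.
  apply: cvgM; first exact: continuous_jump_weight.
  by apply: cvgB; exact: continuous_rotated.
rewrite pE; split; first exact: bounded_mfun_shrink.
have <- : h 1 = rotated o t phi.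
  by rewrite /h mulr1 subrr !mul0r !addr0 expR0 mul1r.
apply/esym; apply: (radial_integral N0 ch cp) => r /andP[r0 _].
exact: rotated_derive.
Qed.

End kernel_step.

(** * The representing measure *)

(** Below some d continuity at 0 gives g < eps. Above d the maximum of g is at most |max g| t / d,
    whence C = |max g| / d. *)
Lemma affine_bound (R : realType) (g : R -> R) : continuous g -> g 0 = 0 ->
  forall eps, 0 < eps -> exists2 C, 0 <= C & forall t, 0 <= t <= 1 -> g t <= eps + C * t.
Proof.
move=> cg g0 e e0.
have [c _ hc] := EVT_max ler01 (continuous_subspaceT cg : {within `[0, 1], continuous g}).
have : \forall t \near (0 : R), `|g t| < e.
  have /cvgrPdist_lt/(_ e e0) := cg 0; apply: filterS => t.
  by rewrite g0 sub0r normrN.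
move=> /nbhs_ballP[d /= d0 hd].
exists (`|g c| / d); first by rewrite divr_ge0// ltW.
move=> t t01; have /andP[t0 t1] := t01; have [td|dt] := ltP t d.
  have := hd t; rewrite /ball/= sub0r normrN ger0_norm// => /(_ td) ge.
  apply: le_trans (ler_norm _) _; apply: le_trans (ltW ge) _.
  by rewrite lerDl mulr_ge0// divr_ge0// ltW.
have := hc t; rewrite in_itv/= => /(_ t01) gt.
apply: le_trans gt _; apply: le_trans (ler_norm _) _.
apply: (@le_trans _ _ (`|g c| / d * t)); last by rewrite lerDr ltW.
by rewrite -mulrA ler_peMr// mulrC ler_pdivlMr// mul1r.
Qed.

Section rotated_near_origin.
Context (R : realType) (n : nat).
Variables (P : {fset 'rV[R]_n}) (k : 'rV[R]_n -> R) (s : 'rV[R[i]]_n).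
Variable f : 'rV[R]_n -> R[i].
Hypothesis hf : opdam_cherednik_kernel P k (s - complexify (rho P k)) f.

(** At t = 0 both functions equal cos phi. Uniformity in [o] comes from summing the deviations over
    [L], uniformity in [phi] from |cos|, |sin| <= 1. *)
Lemma rotated_near (L : seq 'rV[R]_n) (x : 'rV[R]_n) eps : 0 < eps ->
  exists2 C, 0 <= C & forall o t phi, o \in L -> 0 <= t <= 1 ->
    `|rotated f o t phi - wave (re_row s) (im_row s) phi (t *: x)| <= eps + C * t.
Proof.
move=> e0; have [cu cv] := kernel_continuous hf.
pose A (t : R) := expR (t * dot (re_row s) x) * cos (t * dot (im_row s) x).
pose B (t : R) := expR (t * dot (re_row s) x) * sin (t * dot (im_row s) x).
have clin (b : R) : continuous (fun t : R => t * b).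
  by move=> t; apply: cvgMr_tmp; exact: cvg_id.
have cexp : continuous (fun t : R => expR (t * dot (re_row s) x)).
  move=> t; apply: (@continuous_comp _ _ _ (fun t : R => t * dot (re_row s) x) (@expR R)).
    exact: clin.
  exact: continuous_expR.
have cA : continuous A.
  move=> t; apply: cvgM; first exact: cexp.
  apply: (@continuous_comp _ _ _ (fun t : R => t * dot (im_row s) x) (@cos R)).
    exact: clin.
  exact: continuous_cos.
have cB : continuous B.
  move=> t; apply: cvgM; first exact: cexp.
  apply: (@continuous_comp _ _ _ (fun t : R => t * dot (im_row s) x) (@sin R)).
    exact: clin.
  exact: continuous_sin.
pose g o (t : R) := `|complex.Re (f (t *: o)) - A t| + `|complex.Im (f (t *: o)) - B t|.
have cg : continuous (fun t => \sum_(o <- L) g o t).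
  apply: (@continuous_sum R R R^o) => o t; apply: cvgD.
    by apply: cvg_norm; apply: cvgB; [exact: (continuous_ray cu)|exact: cA].
  by apply: cvg_norm; apply: cvgB; [exact: (continuous_ray cv)|exact: cB].
have g0 : \sum_(o <- L) g o 0 = 0.
  rewrite big1// => o _; have [_ _ f0] := hf.
  by rewrite /g /A /B scale0r f0 !mul0r expR0 cos0 sin0 mulr1 mulr0 !subrr normr0 addr0.
have [C C0 hC] := affine_bound cg g0 e0.
exists C => // o t phi oL t01; apply: le_trans (hC t t01).
apply: (@le_trans _ _ (g o t)); last first.
  by rewrite (big_rem o)//= lerDl sumr_ge0// => y _; rewrite addr_ge0.
rewrite /rotated /wave !dotZr cosD.
rewrite (_ : _ - _ = cos phi * (complex.Re (f (t *: o)) - A t) -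
   sin phi * (complex.Im (f (t *: o)) - B t)); last by rewrite /A /B; ring.
apply: le_trans (ler_normB _ _) _; rewrite !normrM /g lerD//.
  by rewrite ler_piMl// ler_norml cos_geN1 cos_le1.
by rewrite ler_piMl// ler_norml sin_geN1 sin_le1.
Qed.

End rotated_near_origin.

Section representing_measure.
Context (R : realType) (n : nat) (Phi P : {fset 'rV[R]_n}).
Hypothesis P_sub : forall a, a \in P -> a \in Phi.
Variables (x : 'rV[R]_n) (k : 'rV[R]_n -> R).
Hypothesis hk0 : forall a, a \in P -> 0 <= k a.
Variable L : seq 'rV[R]_n.
Hypothesis orbitL : weyl_orbit Phi x = [set y | y \in L].
Local Notation V := 'rV[R]_n.
Local Notation U := (unit_uniform R).
Local Notation M := (measurableTypeR R).

(** As [jump_rate v] <= e^|v|, the sum dominates the total jump rate at each orbit point for all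
    times in [0, 1]. The summand 1 keeps the clock positive even if [k] vanishes. *)
Definition clock : R := 1 + \sum_(a <- P) k a * \sum_(y <- L) expR `|dot a y|.

Lemma clock_gt0 : 0 < clock.
Proof.
rewrite ltr_pwDl// big_seq sumr_ge0// => a aP.
by rewrite mulr_ge0 ?hk0// sumr_ge0// => y _; exact: expR_ge0.
Qed.

Local Notation q := (jump_weight clock k).
Local Notation O := (weyl_orbit Phi x).
Local Notation H := (convex_hull O).

Lemma jump_weight_ge0 a o t : a \in (P : seq V) -> 0 <= q a o t.
Proof.
move=> aP; rewrite /jump_weight divr_ge0 ?(ltW clock_gt0)//.
by rewrite mulr_ge0 ?hk0// jump_rate_ge0.
Qed.

Lemma jump_weight_le1 o t : O o -> 0 <= t <= 1 -> weight_sum (fun a => q a o t) P <= 1.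
Proof.
move=> Oo /andP[t0 t1]; rewrite /weight_sum -mulr_suml ler_pdivrMr ?clock_gt0// mul1r.
rewrite /clock ler_wpDl//; rewrite big_seq [leRHS]big_seq; apply: ler_sum => a aP.
rewrite ler_wpM2l ?hk0//; apply: le_trans (jump_rate_le _) _.
have oL : o \in L by have : [set y | y \in L] o by rewrite -orbitL.
rewrite (big_rem o)//=; apply: ler_wpDr; first by rewrite sumr_ge0// => y _; exact: expR_ge0.
by rewrite ler_expR normrM ger0_norm// ler_piMl.
Qed.

Lemma measurable_jump_weight a o : measurable_fun setT (q a o : R -> R).
Proof.
apply: continuous_measurable_fun => t.
have := @continuous_jump_weight R n clock k a o 1 t.
by rewrite /continuous_at mul1r; under eq_fun do rewrite mul1r.
Qed.

Let O_refl a o : a \in (P : seq V) -> O o -> O (reflection a o).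
Proof. by move=> aP; apply: weyl_orbit_reflection; exact: P_sub. Qed.

Let OH : O `<=` H := @sub_convex_hull R n O.

Lemma orbit_coord_bound i : exists C, forall o, O o -> `|o 0 i - x 0 i| <= C.
Proof.
exists (\sum_(y <- L) `|y 0 i - x 0 i|) => o; rewrite orbitL => /= oL.
exact: (seq_bound (fun y => y 0 i - x 0 i)).
Qed.

Definition endpoint_approx (m : nat) (w : R) : V := walk clock P q x m x 1 w.

Definition endpoint (w : M) : borel_rV R n := \row_i limn (fun m => endpoint_approx m w 0 i).

Lemma cvg_endpoint_coord w i :
  endpoint_approx m w 0 i @[m --> \oo] --> (endpoint w : V) 0 i.
Proof.
rewrite /endpoint mxE; apply: (cvg_walk clock_gt0 O_refl) => //.
- exact: weyl_orbit_id.
- exact: orbit_coord_bound.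
- exact: weyl_orbit_id.
Qed.

Lemma measurable_endpoint_approx m i : measurable_fun setT (fun w : M => endpoint_approx m w 0 i).
Proof.
have mp : measurable_fun setT (fun w : M => (1 : M, w)) by exact: measurable_pair1.
exact: (measurableT_comp (measurable_walk clock P x measurable_jump_weight m x i) mp).
Qed.

Lemma measurable_endpoint : measurable_fun setT endpoint.
Proof.
apply: measurable_fun_rV => i.
apply: (@measurable_fun_cvg _ _ _ _ (fun m w => endpoint_approx m w 0 i)).
  by move=> m; exact: measurable_endpoint_approx.
by move=> w _; exact: cvg_endpoint_coord.
Qed.

Lemma cvg_endpoint w : endpoint_approx m w @[m --> \oo] --> (endpoint w : V).
Proof.
apply/cvg_ballP => e e0.
have : \forall m \near \oo, forall i : 'I_n,
    `|(endpoint w : V) 0 i - endpoint_approx m w 0 i| < e.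
  apply: filter_forall => i.
  by have /cvgrPdist_lt/(_ e e0) := @cvg_endpoint_coord w i.
by apply: filterS => m h; split=> // i j; rewrite ord1; exact: h.
Qed.

Lemma endpoint_hull w : H (endpoint w).
Proof.
have cH : closed H.
  by rewrite orbitL; apply: compact_closed; [exact: norm_hausdorff|exact: convex_hull_finite].
suff Hm : \forall m \near \oo, H (endpoint_approx m w).
  exact: (@closed_cvg _ _ _ _ (fun m => endpoint_approx m w) H cH Hm _ (@cvg_endpoint w)).
apply: nearW => m; rewrite /endpoint_approx.
have [h Hh ->] := walk_convex clock_gt0 q O_refl (weyl_orbit_id Phi x) OH
  (@convex_hull_convex R n O) m w (weyl_orbit_id Phi x) ler01.
by rewrite scale1r.
Qed.

Section transform.
Variables (s : 'rV[R[i]]_n) (f : V -> R[i]).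
Hypothesis hf : opdam_cherednik_kernel P k (s - complexify (rho P k)) f.
Local Notation sa := (re_row s).
Local Notation sb := (im_row s).

Lemma continuous_wave phi : continuous (wave sa sb phi).
Proof.
have cd (b : V) : continuous (dot b : V -> R).
  apply: (@continuous_sum R V R^o _ _ (fun i (y : V) => b 0 i * y 0 i)) => i y.
  apply: (@continuous_comp _ _ _ (fun y : V => y 0 i) (fun z : R => b 0 i * z)).
    exact: coord_continuous.
  exact: mulrl_continuous.
have c1 : continuous (fun y : V => expR (dot sa y)).
  move=> y; apply: (@continuous_comp _ _ _ (dot sa : V -> R) (@expR R)).
    exact: cd.
  exact: continuous_expR.
have c2 : continuous (fun y : V => cos (phi + dot sb y)).
  move=> y; apply: (@continuous_comp _ _ _ (fun y : V => phi + dot sb y) (@cos R)).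
    exact: (cvgD (cvg_cst phi) (cd sb y)).
  exact: continuous_cos.
move=> y; exact: (cvgM (c1 y) (c2 y)).
Qed.

(** As m grows, the walk means tend to the right-hand side by dominated convergence, while
    [walk_mean_near] leaves an error of only eps e^K, with eps arbitrary. *)
Lemma rotated_endpoint phi : rotated f x 1 phi = \int[U]_w wave sa sb phi (endpoint w).
Proof.
have [K K0 HK] : exists2 K, 0 <= K & forall h, H h -> `|dot sa h| <= K.
  by rewrite orbitL; exact: hull_dot_bound.
have Ox := weyl_orbit_id Phi x.
have cW : walk_mean clock P q x sa sb m x 1 phi @[m --> \oo] -->
    \int[U]_w wave sa sb phi (endpoint w).
  apply: (mean_cvg (M := expR (K * 1))).
  - by move=> m; apply: measurable_wave => i; exact: measurable_endpoint_approx.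
  - move=> m w; apply: (wave_walk_le clock_gt0 q O_refl Ox OH _ sb HK) => //.
    exact: convex_hull_convex.
  - move=> w; exact: (@cvg_comp _ _ _ (fun m => endpoint_approx m w) (wave sa sb phi) _ _ _
      (@cvg_endpoint w) (@continuous_wave phi _)).
apply/eqP; rewrite -subr_eq0 -normr_le0; apply/ler_addgt0Pr => e e0; rewrite add0r.
(* Chosen so that the factor e^K of [walk_mean_near] turns it back into [e]. *)
have e0' : 0 < e / expR K by rewrite divr_gt0 ?expR_gt0.
have [C C0 hC] := rotated_near hf L x e0'.
have bound m : `|rotated f x 1 phi - walk_mean clock P q x sa sb m x 1 phi| <=
    (e / expR K + C * (clock / (clock + 1)) ^+ m * 1) * expR (K * 1).
  apply: (walk_mean_near clock_gt0 measurable_jump_weight O_refl Ox OH _ HK _ _ _ K0) => //.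
  - exact: convex_hull_convex.
  - by move=> a o t aP _ _; exact: jump_weight_ge0.
  - exact: jump_weight_le1.
  - by move=> o t psi _ _; exact: (rotated_step clock_gt0 hf).
  - exact: ltW.
  - by move=> o t psi; rewrite orbitL => oL t01; exact: hC.
  - by rewrite ler01 lexx.
have c1 : `|rotated f x 1 phi - walk_mean clock P q x sa sb m x 1 phi| @[m --> \oo] -->
    `|rotated f x 1 phi - \int[U]_w wave sa sb phi (endpoint w)|.
  by apply: cvg_norm; apply: cvgB => //; exact: cvg_cst.
have c2 : (e / expR K + C * (clock / (clock + 1)) ^+ m * 1) * expR (K * 1)
    @[m --> \oo] --> (e / expR K + C * 0 * 1) * expR (K * 1).
  apply: cvgMr_tmp; apply: cvgD; first exact: cvg_cst.
  apply: cvgMr_tmp; apply: cvgMl_tmp; apply: cvg_expr.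
  have c0 := clock_gt0; have c10 : 0 < clock + 1 by rewrite addr_gt0.
  rewrite ger0_norm; last by apply: divr_ge0; exact: ltW.
  by rewrite ltr_pdivrMr// mul1r ltrDl.
have eE : (e / expR K + C * 0 * 1) * expR (K * 1) = e.
  by rewrite mulr0 mul0r addr0 mulr1 divfK// gt_eqF// expR_gt0.
rewrite eE in c2; rewrite -(cvg_lim _ c1)// -(cvg_lim _ c2)//; apply: ler_lim.
- by apply/cvg_ex; eexists; exact: c1.
- by apply/cvg_ex; eexists; exact: c2.
- by apply: nearW => m; exact: bound.
Qed.

End transform.

End representing_measure.

Section exponential_rows.
Context (R : realType) (n : nat).
Local Open Scope complex_scope.

Lemma Re_cexp_dot (s : 'rV[R[i]]_n) (y : 'rV[R]_n) :
  complex.Re (cexp (dot s (complexify y))) = wave (re_row s) (im_row s) 0 y.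
Proof. by rewrite dot_complexify /cexp Re_realM /= /wave add0r. Qed.

Lemma Im_cexp_dot (s : 'rV[R[i]]_n) (y : 'rV[R]_n) :
  complex.Im (cexp (dot s (complexify y))) = wave (re_row s) (im_row s) (- (pi / 2)) y.
Proof.
by rewrite dot_complexify /cexp Im_realM /= /wave addrC cosBpihalf.
Qed.

Lemma Re_cexp_real (s y : 'rV[R]_n) :
  complex.Re (cexp (dot (complexify s) (complexify y))) = expR (dot s y).
Proof.
rewrite Re_cexp_dot /wave add0r.
have -> : re_row (complexify s) = s by apply/rowP => i; rewrite !mxE.
have -> : im_row (complexify s) = 0 by apply/rowP => i; rewrite !mxE.
by rewrite (dotC 0) (_ : dot y 0 = 0) ?cos0 ?mulr1// /dot big1// => i _; rewrite mxE mulr0.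
Qed.

End exponential_rows.

Theorem theorem3p2 (R : realType) (n : nat) (Phi P : {fset 'rV[R]_n})
    (hPhi : irreducible_root_system Phi) (hP : positive_system Phi P)
    (x : 'rV[R]_n) (k : 'rV[R]_n -> R) (hk : multiplicity Phi k)
    (hk0 : forall a, a \in Phi -> 0 <= k a)
    (G : 'rV[R[i]]_n -> 'rV[R]_n -> R[i])
    (hG : forall s, opdam_cherednik_kernel P k s (G s)) :
  exists mu : probability (borel_rV R n) R,
    represents Phi P k G x mu /\
    forall mu' : probability (borel_rV R n) R,
      represents Phi P k G x mu' ->
      forall A : set (borel_rV R n), measurable A -> mu' A = mu A.
Proof.
have P_sub a : a \in P -> a \in Phi.
  by have [v [_ ->]] := hP; rewrite !inE => /andP[].
have hkP a : a \in P -> 0 <= k a by move=> /P_sub; exact: hk0.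
have [L orbitL] := weyl_orbit_finite hPhi x.
have mH : @measurable _ (borel_rV R n) (convex_hull (weyl_orbit Phi x)).
  by rewrite orbitL; exact: measurable_hull.
have [B HB] : exists B, forall h : 'rV[R]_n, convex_hull (weyl_orbit Phi x) h ->
    forall i, `|h 0 i| <= B.
  by rewrite orbitL; exact: hull_coord_bound.
pose Y : {mfun measurableTypeR R >-> borel_rV R n} := 
  HB.pack (endpoint P x k L) (isMeasurableFun.Build _ _ _ _ _
    (measurable_endpoint P_sub hkP orbitL)).
have law phi (s : 'rV[R[i]]_n) :
    \int[distribution (unit_uniform R) Y]_y wave (re_row s) (im_row s) phi y =
    rotated (G (s - complexify (rho P k))) x 1 phi.
  rewrite (rotated_endpoint P_sub hkP orbitL (hG _)).
  have mw : measurable_fun setT (fun y : borel_rV R n => wave (re_row s) (im_row s) phi y).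
    by apply: measurable_wave => i; exact: measurable_coord.
  rewrite /Rintegral integral_distribution//; first exact/measurable_EFinP.
  apply: (@bounded_mfun_integrable _ _ R (unit_uniform R)
    (fun w => wave (re_row s) (im_row s) phi (Y w))).
  split; first exact: (measurableT_comp mw (measurable_funP Y)).
  have [K K0 HK] : exists2 K, 0 <= K & forall h,
      convex_hull (weyl_orbit Phi x) h -> `|dot (re_row s) h| <= K.
    by rewrite orbitL; exact: hull_dot_bound.
  exists (expR K) => w; rewrite /wave normrM ger0_norm ?expR_ge0//.
  rewrite -[leRHS]mulr1 ler_pM ?expR_ge0//.
    rewrite ler_expR; apply: le_trans (ler_norm _) _; apply: HK.
    exact: (endpoint_hull P_sub hkP orbitL).
  by rewrite ler_norml cos_geN1 cos_le1.
have rep : represents Phi P k G x (distribution (unit_uniform R) Y).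
  split.
    have Y0 : Y @^-1` (~` convex_hull (weyl_orbit Phi x)) = set0.
      apply/seteqP; split => // w /=; apply.
      exact: (endpoint_hull P_sub hkP orbitL).
    change (unit_uniform R (Y @^-1` (~` convex_hull (weyl_orbit Phi x))) = 0%E).
    by rewrite Y0 measure0.
  move=> s; rewrite /cintegral.
  under eq_Rintegral do rewrite Re_cexp_dot.
  under [X in (_ +i* X)%C]eq_Rintegral do rewrite Im_cexp_dot.
  rewrite !law /rotated scale1r cos0 sin0 mul1r mul0r subr0.
  (* At phase - pi / 2 the function [rotated] is the imaginary part of the kernel. *)
  rewrite cosN sinN cos_pihalf sin_pihalf mul0r sub0r mulN1r opprK.
  by case: (G _ x).
exists (distribution (unit_uniform R) Y); split => // mu' [mu'H mu'G] A mA.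
have [muH muG] := rep.
(* Real spectral parameters already separate the measures: for them the real part of the integrand
   is the real exponential. *)
apply: (probability_eq_laplace mH HB mu'H muH) mA => s.
have reE (Q : probability (borel_rV R n) R) :
    complex.Re (cintegral Q (fun y => cexp (dot (complexify s) (complexify y)))) =
    \int[Q]_y expR (dot s y).
  by apply: eq_Rintegral => y _; exact: Re_cexp_real.
by rewrite -!reE -mu'G -muG.
Qed.
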